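(* Let $\nu=(v_1,v_2,\dots)$ be a sequence of selfadjoint anticommuting unitary operators acting on a Hilbert space $\mathcal H$, let $\mathcal O_\nu=\mathrm{Span}\{1,v_k : k\in\mathbb N\}$, and let $\overline{\mathcal O_\nu}$ be the norm-closure of $\mathcal O_\nu$ in $\mathcal B(\mathcal H)$. Then the unital linear map $\phi:\mathcal O_{{\rm spin}(\aleph_0)}\to\mathcal O_\nu$ in which $\phi(\mathfrak u_k)=v_k$ for every $k\in\mathbb N$ is a unital complete order isomorphism. Moreover, there exists a unital complete order isomorphism $\Phi:\overline{\mathcal O_{{\rm spin}(\aleph_0)}}\to\overline{\mathcal O_\nu}$ such that $\phi=\Phi|_{\mathcal O_{{\rm spin}(\aleph_0)}}$.
   Context: $\mathcal H$ is an infinite-dimensional separable complex Hilbert space and $\mathcal B(\mathcal H)$ is the algebra of bounded operators on it. ''Anticommuting'' means $v_iv_j=-v_jv_i$ for all $i\ne j$. $\mathcal A_{{\rm spin}(\aleph_0)}$ is the universal unital C$^*$-algebra generated by a sequence $\{\mathfrak u_k\}_{k\in\mathbb N}$ subject to the relations $\mathfrak u_k^*=\mathfrak u_k$, $\mathfrak u_k^2=1$ for all $k$, and $\mathfrak u_i\mathfrak u_j+\mathfrak u_j\mathfrak u_i=0$ for all $i\ne j$. $\mathcal O_{{\rm spin}(\aleph_0)}=\mathrm{Span}\{1,\mathfrak u_k: k\in\mathbb N\}\subseteq\mathcal A_{{\rm spin}(\aleph_0)}$, and $\overline{\mathcal O_{{\rm spin}(\aleph_0)}}$ is its norm-closure in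 $\mathcal A_{{\rm spin}(\aleph_0)}$. An operator system is a unital $*$-closed linear subspace $\mathcal R$ of a unital C$^*$-algebra $\mathcal A$; $\mathrm M_n(\mathcal R)_+$ denotes the elements of $\mathrm M_n(\mathcal R)$ positive in $\mathrm M_n(\mathcal A)$. A linear map is completely positive if, for every $n\in\mathbb N$, its entrywise application to $n\times n$ matrices preserves these positive cones. A unital complete order isomorphism is a unital linear bijection $\phi$ with $\phi$ and $\phi^{-1}$ completely positive. *)

(* Defs.v *)
From HB Require Import structures.
From mathcomp Require Import all_boot all_order all_algebra sesquilinear.
From mathcomp Require Import boolp classical_sets functions cardinality reals.
From mathcomp Require Import topology normedtype.
From mathcomp Require Import complex.
From mathcomp Require Import ring lra.

Set Implicit Arguments.
Unset Strict Implicit.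
Unset Printing Implicit Defensive.

Import Order.TTheory GRing.Theory Num.Theory.
Import numFieldNormedType.Exports.
Local Open Scope classical_set_scope.
Local Open Scope ring_scope.
Local Open Scope complex_scope.

(* Norms over R[i] are valued in R[i]; [nrm] is the same norm valued in R. *)
Definition nrm (R : realType) (V : normedModType R[i]) (x : V) : R :=
  complex.Re `|x|.

Section Nrm.
Variables (R : realType) (V : normedModType R[i]).
Implicit Types (x y : V) (a : R[i]).

Lemma nrmE x : `|x| = (nrm x)%:C.
Proof. by rewrite /nrm RRe_real // ger0_real. Qed.

Lemma nrm_ge0 x : 0 <= nrm x.
Proof. by rewrite -lecR -nrmE; exact: normr_ge0. Qed.

Lemma nrmD x y : nrm (x + y) <= nrm x + nrm y.
Proof. by rewrite -lecR rmorphD /= -!nrmE ler_normD. Qed.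

Lemma nrm0 : nrm (0 : V) = 0.
Proof. by rewrite /nrm normr0. Qed.

Lemma nrm0_eq0 x : nrm x = 0 -> x = 0.
Proof. by move=> x0; apply: normr0_eq0; rewrite nrmE x0. Qed.

Lemma nrmN x : nrm (- x) = nrm x.
Proof. by rewrite /nrm normrN. Qed.

Lemma nrmB x y : nrm (x - y) = nrm (y - x).
Proof. by rewrite -nrmN opprB. Qed.

Lemma nrmZ a x : nrm (a *: x) = complex.Re `|a| * nrm x.
Proof.
apply: complexI; rewrite [RHS]rmorphM [LHS](esym (nrmE _)) normrZ (nrmE x).
by rewrite [X in _ = X * _]RRe_real // ger0_real.
Qed.

Lemma nrmZr (r : R) x : 0 <= r -> nrm (r%:C *: x) = r * nrm x.
Proof. by move=> r0; rewrite nrmZ ger0_norm ?lecR. Qed.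

Lemma le_norm_nrm x y : (`|x| <= `|y|) = (nrm x <= nrm y).
Proof. by rewrite !nrmE lecR. Qed.

Lemma nrm_le (M : R) x : (nrm x <= M) = (`|x| <= M%:C).
Proof. by rewrite nrmE lecR. Qed.

End Nrm.

Section FastCvg.
Variable R : realType.

Local Notation dlt n := ((n.+1%:R : R)^-1).

Lemma dlt_gt0 n : 0 < dlt n. Proof. by rewrite invr_gt0. Qed.

Lemma dlt_lt (e : R) : 0 < e -> exists N, forall n, (N <= n)%N -> dlt n < e.
Proof.
move=> e0; exists (Num.truncn e^-1) => n Nn.
rewrite invf_plt ?posrE // ?ltr0n //.
apply: lt_le_trans (truncnS_gt _) _.
by rewrite ler_nat ltnS.
Qed.

Lemma posC (e : R[i]) : 0 < e -> exists2 r : R, 0 < r & e = r%:C.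
Proof.
move=> e0; exists (complex.Re e); last by rewrite RRe_real // gtr0_real.
by move: e0; rewrite ltcE => /andP[].
Qed.

Lemma le_dlt (a b K : R) : 0 <= K -> (forall n, a <= b + K * dlt n) -> a <= b.
Proof.
move=> K0 h; apply/ler_addgt0Pl => e e0.
have K1 : 0 < K + 1 by lra.
have [N hN] := dlt_lt (divr_gt0 e0 K1).
apply: le_trans (h N) _.
have := ltW (hN N (leqnn _)); rewrite ler_pdivlMr // => h1.
have := dlt_gt0 N; set d := _^-1 in h1 *; nra.
Qed.

Lemma fast_cvg (V : completeNormedModType R[i]) (u : nat -> V) (K : R) :
  0 <= K -> (forall n m, nrm (u n - u m) <= K * (dlt n + dlt m)) ->
  exists l, forall n, nrm (u n - l) <= K * dlt n.
Proof.
move=> K0 hu.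
have K1 : 0 < 2 * (K + 1) by lra.
have cu : cauchy (u @ \oo).
  apply/cauchyP => e /posC[r r0 ->].
  have [N hN] := dlt_lt (divr_gt0 r0 K1).
  exists (u N); exists N => // n /= Nn.
  rewrite -ball_normE /= nrmE ltcR.
  apply: le_lt_trans (hu _ _) _.
  have := hN N (leqnn _); have := hN n Nn; rewrite !ltr_pdivlMr //.
  have := dlt_gt0 N; have := dlt_gt0 n.
  by move: (dlt n) (dlt N) => d1 d2; nra.
have /cvg_ex[l /cvgrPdist_lt hl] : cvg (u @ \oo) by exact: cauchy_cvg.
exists l => n; apply: (@le_dlt _ _ (K + 1)); first lra.
move=> k.
have : (0 : R[i]) < (dlt k)%:C by rewrite ltcR dlt_gt0.
move=> /hl [M _ hM].
have := hM (maxn M k) (leq_maxl _ _); rewrite /= nrmE ltcR => h1.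
have := hu n (maxn M k).
have h2 : dlt (maxn M k) <= dlt k.
  by rewrite lef_pV2 ?posrE ?ltr0n // ler_nat ltnS leq_maxr.
have h3 : nrm (u n - l) <= nrm (u n - u (maxn M k)) + nrm (l - u (maxn M k)).
  by rewrite [nrm (l - _)]nrmB; apply: le_trans (nrmD _ _); rewrite addrA subrK.
have := dlt_gt0 k; move: h2 h1 h3.
move: (dlt _) (dlt n) (dlt k) (nrm _) (nrm _) (nrm _) => d1 d2 d3 *; nra.
Qed.

End FastCvg.

HB.mixin Record isHilbert (R : realType) H & CompleteNormedModule R[i] H := {
  inner : {dot H for Num.conj};
  inner_normE : forall x : H, inner x x = `|x| ^+ 2 }.

#[short(type="hilbertType")]
HB.structure Definition Hilbert (R : realType) :=
  {H of CompleteNormedModule R[i] H & isHilbert R H}.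

Section HilbertTheory.
Variables (R : realType) (H : hilbertType R).
Implicit Types x y z : H.

Lemma innerC x y : inner x y = (inner y x)^*.
Proof. by rewrite (hermitian_subproof x y) expr0 mul1r. Qed.

Lemma inner_nrm x : inner x x = (nrm x ^+ 2)%:C.
Proof. by rewrite inner_normE nrmE -rmorphXn. Qed.

Lemma inner_eq0 y : (forall x, inner x y = 0) -> y = 0.
Proof.
move=> h; apply: nrm0_eq0; have := h y; rewrite inner_nrm.
by move=> /eqP; rewrite fmorph_eq0 sqrf_eq0 => /eqP.
Qed.

Lemma inner_inj y z : (forall x, inner x y = inner x z) -> y = z.
Proof.
move=> h; apply/eqP; rewrite -subr_eq0; apply/eqP/inner_eq0 => x.
by rewrite linearBr /= h subrr.
Qed.

Lemma nrm_expand x z (t : R) :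
  nrm (x + t%:C *: z) ^+ 2 =
  nrm x ^+ 2 + 2 * t * complex.Re (inner x z) + t ^+ 2 * nrm z ^+ 2.
Proof.
have -> : forall y, nrm y ^+ 2 = complex.Re (inner y y) by move=> y; rewrite inner_nrm.
rewrite linearDl !linearDr /= !linearZr /= !linearZl /= [inner z x]innerC !inner_nrm.
case: (inner x z) => a b; simpc => /=; ring.
Qed.

Lemma quad_le (A B D : R) : 0 <= A -> 0 <= D ->
  (forall t, 0 <= D ^+ 2 + 2 * t * B + t ^+ 2 * A ^+ 2) -> `|B| <= D * A.
Proof.
move=> A0 D0 h.
have [A1|A1] := eqVneq A 0.
  have [->|B0] := eqVneq B 0; first by rewrite normr0 mulr_ge0.
  have := h (- (D ^+ 2 + 1) / B); rewrite A1 expr0n mulr0 addr0 -mulrA divfK //.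
  nra.
have A2 : 0 < A ^+ 2 by rewrite exprn_gt0 // lt_neqAle eq_sym A1.
rewrite -ler_sqr ?nnegrE ?normr_ge0 ?mulr_ge0 // real_normK ?num_real //.
have := h (- B / A ^+ 2).
have -> : D ^+ 2 + 2 * (- B / A ^+ 2) * B + (- B / A ^+ 2) ^+ 2 * A ^+ 2 =
  D ^+ 2 - B ^+ 2 / A ^+ 2 by field.
by rewrite subr_ge0 ler_pdivrMr // exprMn.
Qed.

Lemma re_inner_le x y : `|complex.Re (inner x y)| <= nrm x * nrm y.
Proof.
apply: quad_le; rewrite ?nrm_ge0 // => t.
by rewrite -nrm_expand sqr_ge0.
Qed.

Lemma phase (c : R[i]) : exists2 a : R[i], `|a| = 1 & a * c = `|c|.
Proof.
have [->|c0] := eqVneq c 0; first by exists 1; rewrite ?normr1 // normr0 mulr0.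
exists (`|c| / c); last by rewrite divfK.
by rewrite normrM normrV ?unitfE // normr_id divff // normr_eq0.
Qed.

Lemma inner_le x y : `|inner x y| <= (nrm x * nrm y)%:C.
Proof.
have [a a1 ha] := phase (inner x y).
have -> : `|inner x y| = (complex.Re (inner (a *: x) y))%:C.
  by rewrite linearZl /= ha RRe_real // ger0_real.
have -> : nrm x = nrm (a *: x) by rewrite nrmZ a1 mul1r.
by rewrite lecR; apply: le_trans (ler_norm _) (re_inner_le _ _).
Qed.

Section Riesz.
Variables (f : H -> R[i]) (M : R).
Hypothesis flin : scalar f.
Hypothesis fbnd : forall x, `|f x| <= (M * nrm x)%:C.

Let J x := nrm x ^+ 2 - 2 * complex.Re (f x).

Let re_f_le x : complex.Re (f x) <= M * nrm x.
Proof.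
rewrite -lecR; apply: le_trans (fbnd x).
by apply: le_trans (normc_ge_Re _); rewrite lecR ler_norm.
Qed.

Let hasJ : has_inf (range J).
Proof.
split; first by exists (J 0); exists 0.
exists (- (M ^+ 2)) => _ [x _ <-]; rewrite /J.
by have := re_f_le x; have := sqr_ge0 (nrm x - M); lra.
Qed.

Lemma riesz : exists y, forall x, f x = inner x y.
Proof.
pose d n : R := n.+1%:R^-1.
have d0 n : 0 < d n by rewrite invr_gt0.
have [y hy] : exists y : nat -> H, forall n, J (y n) < inf (range J) + d n ^+ 2.
  suff /choice [y hy] : forall n, exists x, J x < inf (range J) + d n ^+ 2 by exists y.
  move=> n.
  have [|_ [x _ <-] hx] := @inf_adherent _ (range J) (d n ^+ 2) _ hasJ.
    by rewrite exprn_gt0.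
  by exists x.
have key n z : `|complex.Re (inner z (y n) - f z)| <= d n * nrm z.
  apply: quad_le; rewrite ?nrm_ge0 ?(ltW (d0 n)) // => t.
  have : inf (range J) <= J (y n + t%:C *: z).
    by apply: ge_inf; [case: hasJ|exists (y n + t%:C *: z)].
  have := hy n; rewrite /J nrm_expand.
  have -> : f (y n + t%:C *: z) = f (y n) + t%:C * f z.
    by rewrite addrC flin addrC.
  rewrite [inner _ z]innerC.
  case: (inner z (y n)) => a b; case: (f (y n)) => a' b'; case: (f z) => a'' b''.
  simpc => /=; nra.
have [l hl] : exists l, forall n, nrm (y n - l) <= 1 * d n.
  apply: fast_cvg => // n m; rewrite mul1r -/(d n) -/(d m).
  have [z0|z0] := eqVneq (nrm (y n - y m)) 0; first by rewrite z0 addr_ge0 // ltW.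
  have : nrm (y n - y m) ^+ 2 <= (d n + d m) * nrm (y n - y m).
    have := key n (y n - y m); have := key m (y n - y m).
    have -> : nrm (y n - y m) ^+ 2 = complex.Re (inner (y n - y m) (y n))
        - complex.Re (inner (y n - y m) (y m)).
      by rewrite -raddfB -linearBr /= inner_nrm.
    rewrite !raddfB !ler_norml /=; nra.
  by rewrite expr2 ler_pM2r // lt_neqAle eq_sym z0 nrm_ge0.
have key2 z : complex.Re (f z) = complex.Re (inner z l).
  apply/eqP; rewrite eq_sym -subr_eq0 -normr_le0.
  apply: (@le_dlt _ _ _ (2 * nrm z)); first by rewrite mulr_ge0 ?nrm_ge0.
  move=> n; rewrite -/(d n) add0r.
  have := key n z; have := re_inner_le z (y n - l); have := hl n.
  rewrite linearBr !raddfB !ler_norml /= => h1 /andP[h2 h3] /andP[h4 h5].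
  have := nrm_ge0 z => z0.
  by apply/andP; split; nra.
exists l => z.
have h1 := key2 z; have := key2 ('i%C *: z).
rewrite linearZl /=.
have -> : f ('i%C *: z) = 'i%C * f z.
  have f0 : f 0 = 0.
    by have := flin 1 0 0; rewrite scale1r addr0 mul1r -[X in X = _]addr0 => /addrI/esym.
  by have := flin 'i%C z 0; rewrite !addr0 f0 addr0.
move: h1; case: (f z) => a b; case: (inner z l) => a' b' /= ->; simpc => /=.
by move=> /oppr_inj ->.
Qed.

End Riesz.
End HilbertTheory.

Definition lspan (K : pzRingType) (V : lmodType K) (S : set V) : set V :=
  [set x | exists n (a : 'I_n -> K) (s : 'I_n -> V),
     (forall i, S (s i)) /\ x = \sum_(i < n) a i *: s i].

HB.mixin Record isSeparableInfDim (R : realType) H & Hilbert R H := {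
  separable : exists2 D : set H, countable D & dense D;
  infinite_dim : forall n (e : 'I_n -> H), lspan (range e) <> setT }.

#[short(type="sepHilbertType")]
HB.structure Definition SepHilbert (R : realType) :=
  {H of Hilbert R H & isSeparableInfDim R H}.

(* The norm is R-valued and part of this mixin: an algebra over R[i] cannot
   inherit from normedModType, because HB takes numDomainType to be the join of
   rings and normed Z-modules. *)
HB.mixin Record isCStarAlgebra (R : realType) A & GRing.Algebra R[i] A := {
  star : A -> A;
  starK : involutive star;
  starD : forall a b : A, star (a + b) = star a + star b;
  starZ : forall (c : R[i]) (a : A), star (c *: a) = c^* *: star a;
  starM : forall a b : A, star (a * b) = star b * star a;
  cnorm : A -> R;
  cnormD : forall a b : A, cnorm (a + b) <= cnorm a + cnorm b;
  cnormZ : forall (c : R[i]) (a : A), (cnorm (c *: a))%:C = `|c| * (cnorm a)%:C;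
  cnorm0_eq0 : forall a : A, cnorm a = 0 -> a = 0;
  cnormM : forall a b : A, cnorm (a * b) <= cnorm a * cnorm b;
  cnorm_star : forall a : A, cnorm (star a * a) = cnorm a ^+ 2;
  cnorm_complete : forall a : nat -> A,
    (forall e : R, 0 < e -> exists N, forall m n,
      (N <= m)%N -> (N <= n)%N -> cnorm (a m - a n) < e) ->
    exists l : A, forall e : R, 0 < e -> exists N, forall n,
      (N <= n)%N -> cnorm (a n - l) < e }.

#[short(type="cstarAlgType")]
HB.structure Definition CStarAlgebra (R : realType) :=
  {A of GRing.Algebra R[i] A & isCStarAlgebra R A}.

Definition bounded_op (R : realType) (H : hilbertType R) : {pred H -> H} :=
  fun T => `[< linear T /\ exists M : R, forall x, nrm (T x) <= M * nrm x >].

Arguments bounded_op {R} H _.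

Record bop (R : realType) (H : hilbertType R) := Bop {
  bop_fun :> H -> H;
  bop_axiom : bop_fun \in bounded_op H }.

Section BoundedOperators.
Variables (R : realType) (H : hilbertType R).

HB.instance Definition _ := [isSub for @bop_fun R H].
HB.instance Definition _ := [Choice of bop H by <:].

Lemma bounded_op_submod : submod_closed (bounded_op H).
Proof.
split.
  apply/asboolP; split; first by move=> a x y; rewrite scaler0 addr0.
  by exists 0 => x; rewrite nrm0 mul0r.
move=> a f g /asboolP[flin [M fM]] /asboolP[glin [N gN]]; apply/asboolP; split.
  move=> b x y; rewrite !fctE /= flin glin !scalerDr !scalerA mulrC.
  by rewrite !addrA; congr (_ + _); rewrite -!addrA; congr (_ + _); rewrite addrC.
exists (complex.Re `|a| * M + N) => x; rewrite mulrDl.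
apply: le_trans (nrmD _ _) (lerD _ (gN x)).
rewrite nrmZ -mulrA ler_wpM2l //.
by rewrite -lecR RRe_real ?normr_ge0 // ger0_real.
Qed.

HB.instance Definition _ :=
  GRing.isSubmodClosed.Build R[i] (H -> H) (bounded_op H) bounded_op_submod.
HB.instance Definition _ := [SubChoice_isSubLmodule of bop H by <:].

Implicit Types S T U : bop H.

Lemma bopP S T : (forall x, S x = T x) -> S = T.
Proof. by move=> h; apply/val_inj/funext. Qed.

Lemma bop_linear T : linear T.
Proof. by have /asboolP[] := bop_axiom T. Qed.

HB.instance Definition _ T :=
  GRing.isLinear.Build R[i] H H *:%R (bop_fun T) (@bop_linear T).

Lemma bop_bounded T : exists2 M : R, 0 <= M & forall x, nrm (T x) <= M * nrm x.
Proof.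
have /asboolP[_ [M hM]] := bop_axiom T; exists `|M| => // x.
by apply: le_trans (hM x) _; rewrite ler_wpM2r ?nrm_ge0 // ler_norm.
Qed.

Lemma bopDE S T x : (S + T) x = S x + T x. Proof. by []. Qed.
Lemma bopZE a T x : (a *: T) x = a *: T x. Proof. by []. Qed.
Lemma bopNE T x : (- T) x = - T x. Proof. by []. Qed.

Lemma mk_bop_subproof (f : H -> H) (M : R) : linear f ->
  (forall x, nrm (f x) <= M * nrm x) -> f \in bounded_op H.
Proof. by move=> fl fM; apply/asboolP; split=> //; exists M. Qed.

Definition mk_bop f M fl fM : bop H := Bop (@mk_bop_subproof f M fl fM).

Lemma bop_comp_subproof S T : S \o T \in bounded_op H.
Proof.
have [M M0 hM] := bop_bounded S; have [N N0 hN] := bop_bounded T.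
apply/asboolP; split=> [a x y|]; first by rewrite /= !linearP.
exists (M * N) => x; apply: le_trans (hM _) _.
by rewrite -mulrA ler_wpM2l.
Qed.

Lemma bop_id_subproof : idfun \in bounded_op H.
Proof. by apply/asboolP; split=> //; exists 1 => x; rewrite mul1r. Qed.

Definition bop_comp S T := Bop (bop_comp_subproof S T).
Definition bop_id := Bop bop_id_subproof.

Lemma bop_compA : associative bop_comp. Proof. by move=> S T U; apply: bopP. Qed.
Lemma bop_comp1l : left_id bop_id bop_comp. Proof. by move=> T; apply: bopP. Qed.
Lemma bop_comp1r : right_id bop_id bop_comp. Proof. by move=> T; apply: bopP. Qed.
Lemma bop_compDl : left_distributive bop_comp +%R.
Proof. by move=> S T U; apply: bopP. Qed.
Lemma bop_compDr : right_distributive bop_comp +%R.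
Proof. by move=> S T U; apply: bopP => x; rewrite bopDE /= linearD. Qed.

HB.instance Definition _ := GRing.Zmodule_isPzRing.Build (bop H)
  bop_compA bop_comp1l bop_comp1r bop_compDl bop_compDr.

Lemma bopME S T x : (S * T) x = S (T x). Proof. by []. Qed.
Lemma bop1E x : (1 : bop H) x = x. Proof. by []. Qed.

Definition opnorm T : R := sup [set nrm (T x) | x in [set x | nrm x <= 1]].

Let opnorm_has_sup T : has_sup [set nrm (T x) | x in [set x | nrm x <= 1]].
Proof.
split; first by exists (nrm (T 0)), 0 => //=; rewrite nrm0.
have [M M0 hM] := bop_bounded T; exists M => _ [x /= x1 <-].
by apply: le_trans (hM x) _; rewrite ler_piMr.
Qed.

Lemma opnorm_ge0 T : 0 <= opnorm T.
Proof.
apply: le_trans (nrm_ge0 (T 0)) _.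
by apply: ub_le_sup; [case: (opnorm_has_sup T)|exists 0 => //=; rewrite nrm0].
Qed.

Lemma opnormP T x : nrm (T x) <= opnorm T * nrm x.
Proof.
have [->|x0] := eqVneq x 0; first by rewrite linear0 nrm0 mulr0.
have nx : 0 < nrm x.
  rewrite lt_neqAle nrm_ge0 andbT eq_sym; apply: contra_neq x0; exact: nrm0_eq0.
rewrite -ler_pdivrMr // mulrC -nrmZr ?invr_ge0 ?nrm_ge0 // -linearZ /=.
apply: ub_le_sup; first by case: (opnorm_has_sup T).
by eexists; last reflexivity; rewrite /= nrmZr ?invr_ge0 ?nrm_ge0 // mulVf ?gt_eqF.
Qed.

Lemma opnorm_le T M : 0 <= M -> (forall x, nrm (T x) <= M * nrm x) -> opnorm T <= M.
Proof.
move=> M0 hM; apply: ge_sup; first by case: (opnorm_has_sup T).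
by move=> _ [x /= x1 <-]; apply: le_trans (hM x) _; rewrite ler_piMr.
Qed.

Lemma opnormD S T : opnorm (S + T) <= opnorm S + opnorm T.
Proof.
apply: opnorm_le; first by rewrite addr_ge0 ?opnorm_ge0.
move=> x; rewrite mulrDl; apply: le_trans (nrmD _ _) _.
by rewrite lerD ?opnormP.
Qed.

Let re_norm_ge0 (c : R[i]) : 0 <= complex.Re `|c|.
Proof. exact: (@nrm_ge0 R (R[i]^o : normedModType R[i]) c). Qed.

Let opnormZ_le (c : R[i]) T : opnorm (c *: T) <= complex.Re `|c| * opnorm T.
Proof.
apply: opnorm_le => [|x]; first by rewrite mulr_ge0 ?opnorm_ge0.
by rewrite bopZE nrmZ -mulrA ler_wpM2l ?opnormP.
Qed.

Lemma opnormZ (c : R[i]) T : (opnorm (c *: T))%:C = `|c| * (opnorm T)%:C.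
Proof.
have -> : `|c| = (complex.Re `|c|)%:C by rewrite RRe_real // ger0_real.
rewrite -rmorphM; congr _%:C; apply/eqP; rewrite eq_le opnormZ_le andTb.
have [->|c0] := eqVneq c 0; first by rewrite normr0 mul0r opnorm_ge0.
have nc : 0 < complex.Re `|c|.
  by have : 0 < `|c| by [rewrite normr_gt0]; rewrite ltcE => /andP[].
rewrite -ler_pdivlMl //; have := opnormZ_le c^-1 (c *: T).
rewrite scalerA mulVf // scale1r normfV.
suff -> : complex.Re (`|c|^-1) = (complex.Re `|c|)^-1 by [].
have -> : `|c| = (complex.Re `|c|)%:C by rewrite RRe_real // ger0_real.
by rewrite -fmorphV.
Qed.

Lemma opnorm0_eq0 T : opnorm T = 0 -> T = 0.
Proof.
move=> T0; apply: bopP => x; apply: nrm0_eq0; apply/eqP.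
by rewrite eq_le nrm_ge0 andbT; have := opnormP T x; rewrite T0 mul0r.
Qed.

Let opnorm_fast_cvg (u : nat -> bop H) :
  (forall n m, opnorm (u n - u m) <= n.+1%:R^-1 + m.+1%:R^-1) ->
  exists l, forall n, opnorm (u n - l) <= n.+1%:R^-1.
Proof.
move=> hu; pose d n : R := n.+1%:R^-1.
have d0 n : 0 <= d n by rewrite invr_ge0.
have hux x n m : nrm (u n x - u m x) <= nrm x * (d n + d m).
  apply: le_trans (opnormP (u n - u m) x) _.
  by rewrite mulrC ler_wpM2l ?nrm_ge0 ?hu.
have /choice [l hl] x : exists l, forall n, nrm (u n x - l) <= nrm x * d n.
  by apply: fast_cvg => //; rewrite nrm_ge0.
have llin : linear l.
  move=> a x y; apply/eqP; rewrite -subr_eq0; apply/eqP/nrm0_eq0/eqP.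
  rewrite eq_le nrm_ge0 andbT.
  apply: (@le_dlt _ _ _ (nrm (a *: x + y) + complex.Re `|a| * nrm x + nrm y)).
    by rewrite !addr_ge0 ?mulr_ge0 ?nrm_ge0.
  move=> n; rewrite add0r -/(d n).
  have -> : l (a *: x + y) - (a *: l x + l y) =
     (l (a *: x + y) - u n (a *: x + y)) + a *: (u n x - l x) + (u n y - l y).
    have id4 (p b c b' c' : H) :
        p - (b' + c') = (p - (b + c)) + (b - b') + (c - c').
      by rewrite -addrA [X in _ = _ + X]addrACA -opprD addrA subrK.
    by rewrite [u n (_ + _)]linearP scalerBr -id4.
  rewrite !mulrDl; apply: le_trans (nrmD _ _) (lerD _ (hl y n)).
  apply: le_trans (nrmD _ _) (lerD _ _); first by rewrite nrmB hl.
  by rewrite nrmZ -mulrA ler_wpM2l.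
have lbnd x : nrm (l x) <= (opnorm (u 0%N) + 1) * nrm x.
  have -> : l x = u 0%N x - (u 0%N x - l x) by rewrite subKr.
  apply: le_trans (nrmD _ _) _; rewrite nrmN mulrDl lerD ?opnormP //.
  by apply: le_trans (hl x 0%N) _; rewrite /d invr1 mulrC.
exists (mk_bop llin lbnd) => n; apply: opnorm_le => [|x]; first exact: d0.
by rewrite mulrC; apply: hl.
Qed.

Lemma opnorm_complete (u : nat -> bop H) :
  (forall e : R, 0 < e -> exists N, forall m n,
    (N <= m)%N -> (N <= n)%N -> opnorm (u m - u n) < e) ->
  exists l, forall e : R, 0 < e -> exists N, forall n,
    (N <= n)%N -> opnorm (u n - l) < e.
Proof.
move=> cu.
have /choice [N hN] k : exists N, forall m n, (N <= m)%N -> (N <= n)%N ->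
    opnorm (u m - u n) < k.+1%:R^-1.
  by apply: cu; rewrite invr_gt0.
have tri a b c : opnorm (a - c) <= opnorm (a - b) + opnorm (b - c).
  by apply: le_trans (opnormD _ _); rewrite addrA subrK.
have [n m|l hl] := @opnorm_fast_cvg (u \o N).
  pose p := maxn (N n) (N m).
  apply: le_trans (tri _ (u p) _) (lerD _ _); apply: ltW; apply: hN => //.
    exact: leq_maxl.
  exact: leq_maxr.
exists l => e e0; have [k hk] := dlt_lt (divr_gt0 e0 (ltr0n R 2)).
exists (N k) => n Nn; have := hN k _ _ Nn (leqnn _); have := hl k.
have := hk k (leqnn _); have := tri (u n) (u (N k)) l.
rewrite /=; move: (k.+1%:R^-1) => d; lra.
Qed.

Lemma adjoint_exists T : exists S, forall x y, inner (T x) y = inner x (S y).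
Proof.
have /choice [s hs] y : exists z, forall x, inner (T x) y = inner x z.
  apply: (@riesz _ _ _ (opnorm T * nrm y)) => [a u v|x].
    by rewrite linearP linearPl.
  apply: le_trans (inner_le _ _) _; rewrite lecR mulrAC ler_wpM2r ?nrm_ge0 //.
  exact: opnormP.
have slin : linear s.
  move=> a y z; apply: inner_inj => x.
  by rewrite -hs !linearPr /= !hs.
suff sbnd y : nrm (s y) <= opnorm T * nrm y.
  by exists (mk_bop slin sbnd) => x y; rewrite hs.
have [->|s0] := eqVneq (nrm (s y)) 0; first by rewrite mulr_ge0 ?nrm_ge0 ?opnorm_ge0.
have s1 : 0 < nrm (s y) by rewrite lt_neqAle eq_sym s0 nrm_ge0.
rewrite -(ler_pM2r s1) -expr2 -lecR -inner_nrm -hs -[leLHS]ger0_norm; last first.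
  by rewrite hs inner_nrm lecR sqr_ge0.
apply: le_trans (inner_le _ _) _; rewrite lecR mulrAC ler_wpM2r ?nrm_ge0 //.
exact: opnormP.
Qed.

Definition adjoint T : bop H := sval (cid (adjoint_exists T)).

Lemma adjointP T x y : inner (T x) y = inner x (adjoint T y).
Proof. exact: (svalP (cid (adjoint_exists T))). Qed.

Lemma adjoint_uniq T S : (forall x y, inner (T x) y = inner x (S y)) -> S = adjoint T.
Proof. by move=> h; apply: bopP => y; apply: inner_inj => x; rewrite -h adjointP. Qed.

Lemma adjointK : involutive adjoint.
Proof.
move=> T; apply/esym/adjoint_uniq => x y.
by rewrite innerC -adjointP -innerC.
Qed.

Lemma adjointD S T : adjoint (S + T) = adjoint S + adjoint T.
Proof.
apply/esym/adjoint_uniq => x y.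
by rewrite !bopDE linearDl linearDr /= !adjointP.
Qed.

Lemma adjointZ (c : R[i]) T : adjoint (c *: T) = c^* *: adjoint T.
Proof.
apply/esym/adjoint_uniq => x y.
by rewrite !bopZE linearZl linearZr /= adjointP conjCK.
Qed.

Lemma adjointM S T : adjoint (S * T) = adjoint T * adjoint S.
Proof. by apply/esym/adjoint_uniq => x y; rewrite !bopME -!adjointP. Qed.

Lemma opnormM S T : opnorm (S * T) <= opnorm S * opnorm T.
Proof.
apply: opnorm_le => [|x]; first by rewrite mulr_ge0 ?opnorm_ge0.
rewrite bopME -mulrA; apply: le_trans (opnormP _ _) _.
by rewrite ler_wpM2l ?opnorm_ge0 ?opnormP.
Qed.

Lemma opnorm_sqr_le T : opnorm T ^+ 2 <= opnorm (adjoint T * T).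
Proof.
set M := opnorm (adjoint T * T).
have M0 : 0 <= M by exact: opnorm_ge0.
rewrite -[leRHS]sqr_sqrtr // ler_sqr ?nnegrE ?opnorm_ge0 ?sqrtr_ge0 //.
apply: opnorm_le => [|x]; first exact: sqrtr_ge0.
rewrite -ler_sqr ?nnegrE ?nrm_ge0 ?mulr_ge0 ?sqrtr_ge0 ?nrm_ge0 //.
rewrite exprMn sqr_sqrtr // -lecR -inner_nrm adjointP -bopME.
rewrite -[leLHS]ger0_norm; last first.
  by rewrite bopME -adjointP inner_nrm lecR sqr_ge0.
apply: le_trans (inner_le _ _) _; rewrite lecR mulrC expr2 mulrA.
by rewrite ler_wpM2r ?nrm_ge0 ?opnormP.
Qed.

Lemma opnorm_adjoint_le T : opnorm T <= opnorm (adjoint T).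
Proof.
have [->|T0] := eqVneq (opnorm T) 0; first exact: opnorm_ge0.
have T1 : 0 < opnorm T by rewrite lt_neqAle eq_sym T0 opnorm_ge0.
rewrite -(ler_pM2r T1) -expr2; apply: le_trans (opnorm_sqr_le T) _.
exact: opnormM.
Qed.

Lemma opnorm_cstar T : opnorm (adjoint T * T) = opnorm T ^+ 2.
Proof.
apply/eqP; rewrite eq_le opnorm_sqr_le andbT.
apply: le_trans (opnormM _ _) _; rewrite expr2 ler_wpM2r ?opnorm_ge0 //.
by rewrite -{2}(adjointK T); apply: opnorm_adjoint_le.
Qed.

End BoundedOperators.

Section BoundedOperatorsCStar.
Variables (R : realType) (H : sepHilbertType R).

Lemma bop_1_neq0 : 1 != 0 :> bop H.
Proof.
apply/eqP => e10.
have x0 (x : H) : x = 0 by rewrite -(bop1E x) e10.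
apply: (@infinite_dim R H 0%N (fun=> 0)).
apply/seteqP; split=> // x _; exists 0%N, (fun=> 0), (fun=> 0).
by split=> [[]//|]; rewrite big_ord0 (x0 x).
Qed.

HB.instance Definition _ := GRing.PzSemiRing_isNonZero.Build (bop H) bop_1_neq0.

Lemma bop_scalerAl (c : R[i]) (S T : bop H) : c *: (S * T) = (c *: S) * T.
Proof. exact: bopP. Qed.

Lemma bop_scalerAr (c : R[i]) (S T : bop H) : c *: (S * T) = S * (c *: T).
Proof. by apply: bopP => x; rewrite bopME !bopZE linearZ. Qed.

HB.instance Definition _ := GRing.Lmodule_isLalgebra.Build R[i] (bop H) bop_scalerAl.
HB.instance Definition _ := GRing.Lalgebra_isAlgebra.Build R[i] (bop H) bop_scalerAr.
HB.instance Definition _ := isCStarAlgebra.Build R (bop H)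
  (@adjointK R H) (@adjointD R H) (@adjointZ R H) (@adjointM R H)
  (@opnormD R H) (@opnormZ R H) (@opnorm0_eq0 R H)
  (@opnormM R H) (@opnorm_cstar R H) (@opnorm_complete R H).

End BoundedOperatorsCStar.

Section CStarTheory.
Variables (R : realType) (A : cstarAlgType R).
Implicit Types a b : A.

Lemma star0 : star (0 : A) = 0.
Proof. by have := starZ 0 (0 : A); rewrite conjC0 !scale0r. Qed.

Lemma star1 : star (1 : A) = 1.
Proof. by rewrite -[LHS]mulr1 -{2}(starK 1) -starM mulr1 starK. Qed.

Lemma cnorm0 : cnorm (0 : A) = 0.
Proof. by apply: complexI; have := cnormZ 0 (0 : A); rewrite scale0r normr0 mul0r. Qed.

Lemma cnorm_ge0 a : 0 <= cnorm a.
Proof.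
have cN : cnorm (- a) = cnorm a.
  by apply: complexI; rewrite -scaleN1r cnormZ normrN1 mul1r.
by have := cnormD a (- a); rewrite subrr cnorm0 cN; lra.
Qed.

Lemma cnorm_starE a : cnorm (star a) = cnorm a.
Proof.
have le b : cnorm b <= cnorm (star b).
  have [->|b0] := eqVneq (cnorm b) 0; first exact: cnorm_ge0.
  have b1 : 0 < cnorm b by rewrite lt_neqAle eq_sym b0 cnorm_ge0.
  by rewrite -(ler_pM2r b1) -expr2 -cnorm_star cnormM.
by apply/eqP; rewrite eq_le le andbT -{2}(starK a) le.
Qed.

End CStarTheory.

Definition nclosure (R : realType) (A : cstarAlgType R) (S : set A) : set A :=
  [set a | forall e : R, 0 < e -> exists2 b, S b & cnorm (a - b) < e].

Definition adjmx (R : realType) (A : cstarAlgType R) n (X : 'M[A]_n) : 'M[A]_n :=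
  map_mx star X^T.

(* The positive elements of the C*-algebra M_n(A) are those of the form Y* Y; this
   needs only the *-algebra structure of M_n(A), not its norm. *)
Definition mxpos (R : realType) (A : cstarAlgType R) n (X : 'M[A]_n) : Prop :=
  exists Y : 'M[A]_n, X = adjmx Y *m Y.

Definition operator_system (R : realType) (A : cstarAlgType R) (S : set A) :=
  [/\ S 1,
      forall a, S a -> S (star a) &
      forall (c : R[i]) a b, S a -> S b -> S (c *: a + b)].

Record opsys (R : realType) (A : cstarAlgType R) := OpSys {
  os_set : set A;
  os_axiom : operator_system os_set }.

Definition os_pred (R : realType) (A : cstarAlgType R) (S : opsys A) : {pred A} :=
  fun a => `[< os_set S a >].

Record os_elt (R : realType) (A : cstarAlgType R) (S : opsys A) := OsElt {
  os_val :> A;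
  os_valP : os_val \in os_pred S }.

Section OperatorSystems.
Variables (R : realType) (A : cstarAlgType R) (S : opsys A).

HB.instance Definition _ := [isSub for @os_val R A S].
HB.instance Definition _ := [Choice of os_elt S by <:].

Lemma os_submod : submod_closed (os_pred S).
Proof.
have [S1 _ SZD] := os_axiom S; split=> [|c a b /asboolP Sa /asboolP Sb].
  by apply/asboolP; rewrite -(subrr 1) addrC -scaleN1r; apply: SZD.
by apply/asboolP; apply: SZD.
Qed.

HB.instance Definition _ :=
  GRing.isSubmodClosed.Build R[i] A (os_pred S) os_submod.
HB.instance Definition _ := [SubChoice_isSubLmodule of os_elt S by <:].

Lemma os_one_subproof : 1 \in os_pred S.
Proof. by apply/asboolP; case: (os_axiom S). Qed.

Definition os_one : os_elt S := OsElt os_one_subproof.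

Definition os_pos n (X : 'M[os_elt S]_n) : Prop :=
  mxpos (map_mx (@os_val R A S) X).

Lemma nclosure_operator_system : operator_system (nclosure (os_set S)).
Proof.
have [S1 SS SZD] := os_axiom S; split.
- by move=> e e0; exists 1 => //; rewrite subrr cnorm0.
- move=> a Sa e e0; have [b Sb hb] := Sa e e0.
  exists (star b); first exact: SS.
  by rewrite -scaleN1r -[-1]conjCK -starZ -starD rmorphN1 scaleN1r cnorm_starE.
- move=> c a b Sa Sb e e0.
  pose r : R := complex.Re `|c|.
  have rE : `|c| = r%:C by rewrite /r RRe_real // ger0_real.
  have r0 : 0 <= r by rewrite -lecR -rE; exact: normr_ge0.
  have r1 : 0 < 2 * (r + 1) by lra.
  have [a' Sa' ha] := Sa _ (divr_gt0 e0 r1).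
  have [b' Sb' hb] := Sb _ (divr_gt0 e0 (ltr0n R 2)).
  exists (c *: a' + b'); first exact: SZD.
  rewrite opprD addrACA -scalerBr; apply: le_lt_trans (cnormD _ _) _.
  have -> : cnorm (c *: (a - a')) = r * cnorm (a - a').
    by apply: complexI; rewrite cnormZ rE rmorphM.
  move: ha; rewrite ltr_pdivlMr // => ha.
  have := cnorm_ge0 (a - a').
  move: (cnorm (a - a')) (cnorm (b - b')) ha hb => x y; nra.
Qed.

Definition os_closure : opsys A := OpSys nclosure_operator_system.

Lemma os_incl_subproof (x : os_elt S) : os_val x \in os_pred os_closure.
Proof.
apply/asboolP => e e0; exists (os_val x); last by rewrite subrr cnorm0.
exact/asboolP/os_valP.
Qed.

Definition os_incl (x : os_elt S) : os_elt os_closure := OsElt (os_incl_subproof x).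

End OperatorSystems.

Coercion os_elt : opsys >-> Sortclass.

Section CompleteOrder.
Variables (R : realType) (A B : cstarAlgType R) (S : opsys A) (T : opsys B).

Definition completely_positive (phi : {linear S -> T}) : Prop :=
  forall n (X : 'M[S]_n), os_pos X -> os_pos (map_mx phi X).

Definition unital (phi : {linear S -> T}) : Prop := phi (os_one S) = os_one T.

End CompleteOrder.

Definition unital_complete_order_iso (R : realType) (A B : cstarAlgType R)
    (S : opsys A) (T : opsys B) (phi : {linear S -> T}) : Prop :=
  [/\ unital phi, completely_positive phi &
      exists psi : {linear T -> S},
        [/\ cancel phi psi, cancel psi phi & completely_positive psi]].

Section SpanSystem.
Variables (R : realType) (A : cstarAlgType R) (g : nat -> A).
Hypothesis g_sa : forall k, star (g k) = g k.

Lemma span_operator_system : operator_system (lspan (1 |` range g)).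
Proof.
split.
- exists 1%N, (fun=> 1), (fun=> 1); split; first by left.
  by rewrite big_ord1 scale1r.
- move=> _ [n [c [s [Ss ->]]]].
  exists n, (fun i => (c i)^*), s; split=> //.
  rewrite (big_morph _ (@starD _ _) (star0 A)); apply: eq_bigr => i _.
  rewrite starZ; congr (_ *: _).
  by case: (Ss i) => [->|[k _ <-]]; rewrite ?star1.
- move=> a _ _ [n [c [s [Ss ->]]]] [m [d [t [St ->]]]].
  exists (n + m)%N,
    (fun i => match fintype.split i with inl j => a * c j | inr j => d j end),
    (fun i => match fintype.split i with inl j => s j | inr j => t j end).
  split=> [i|]; first by case: (fintype.split i).
  rewrite big_split_ord scaler_sumr /=; congr (_ + _); apply: eq_bigr => i _.
    by rewrite (unsplitK (inl _ i)) scalerA.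
  by rewrite (unsplitK (inr _ i)).
Qed.

Definition span_os : opsys A := OpSys span_operator_system.

Lemma span_gen_subproof k : g k \in os_pred span_os.
Proof.
apply/asboolP; exists 1%N, (fun=> 1), (fun=> g k); split; first by right; exists k.
by rewrite big_ord1 scale1r.
Qed.

Definition span_gen k : span_os := OsElt (span_gen_subproof k).

End SpanSystem.

Definition cstar_subalgebra (R : realType) (A : cstarAlgType R) (S : set A) :=
  [/\ operator_system S,
      forall a b, S a -> S b -> S (a * b) &
      nclosure S `<=` S].

Definition cstar_generated (R : realType) (A : cstarAlgType R) (g : nat -> A) :=
  forall S : set A, cstar_subalgebra S -> range g `<=` S -> S = setT.

Definition spin_relations (R : realType) (A : cstarAlgType R) (u : nat -> A) :=
  [/\ forall k, star (u k) = u k,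
      forall k, u k ^+ 2 = 1 &
      forall i j, i != j -> u i * u j + u j * u i = 0].

(* The pair (A, u) is the universal unital C*-algebra on the spin relations; this
   determines it up to a unique *-isomorphism matching the generators. *)
Definition spin_universal (R : realType) (A : cstarAlgType R) (u : nat -> A) :=
  [/\ spin_relations u,
      cstar_generated u &
      forall (B : cstarAlgType R) (w : nat -> B), spin_relations w ->
        exists f : {lrmorphism A -> B},
          {morph f : a / star a} /\ forall k, f (u k) = w k].

Lemma spin_universal_sa (R : realType) (A : cstarAlgType R) (u : nat -> A) :
  spin_universal u -> forall k, star (u k) = u k.
Proof. by case=> [[]]. Qed.

Definition unitary_elt (R : realType) (A : cstarAlgType R) (a : A) :=
  star a * a = 1 /\ a * star a = 1.

(* Main.v *)
Require Import Defs.
From HB Require Import structures.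
From mathcomp Require Import all_boot all_order all_algebra.
From mathcomp Require Import boolp classical_sets functions reals.
From mathcomp Require Import complex.
From mathcomp Require Import ring lra.
Set Implicit Arguments.
Unset Strict Implicit.
Unset Printing Implicit Defensive.
Import Order.TTheory GRing.Theory Num.Theory.
Local Open Scope ring_scope.
Local Open Scope complex_scope.

(** The universal property supplies a unital *-homomorphism f from A to B(H)
    with f (u k) = v k, and everything follows once f is known to be isometric:
    the two order isomorphisms are then restrictions of f.

    A *-homomorphism is contractive ([morph_contractive]).  For the reverse
    inequality, consider the finite-dimensional algebras A_m generated by
    u 0, ..., u (m-1).  They satisfy A_(m+1) = A_m + A_m u_m, and, because the
    sequence of generators never ends, s = u_m u_(m+1) is a unitary that commutes
    with A_m and anticommutes with u_m.  Hence the component a of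
    b = a + c u_m is recovered as (b + s b s')/2, where s' = star s, and its image
    f a has norm at most that of f b.  By induction the norm of b is at most 3^m times that of
    f b for all b in A_m ([tower_bound]).  Applied to the powers b^(2^k) of a
    self-adjoint b, whose norms are the powers |b|^(2^k), this bound improves to
    the constant 1 ([tower_isometric]), and the union of the A_m is dense
    ([tower_dense]).

    Since M_n(A)_+ consists of the products (star Y) Y, a *-homomorphism is completely
    positive.  For the inverse, let f X = (star Z) Z with Z a matrix of operators.
    After scaling, Z is a contraction of H^n, hence so is 1 - (star Z) Z = f T with
    T = 1 - X; by isometry the entries of all powers of T have norm at most 1,
    and the square root of 1 - T = X can be computed inside M_n(A)
    ([sqrt_1B], [mxpos_reflect]).  The same square root, for n = 1, is what makes
    f contractive: it writes 1 - (star a) a as (star y) y when a is in the unit ball.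

    Finally, an isometry maps the closure of a subspace onto the closure of its
    image ([nclosure_image]), so that the same argument applies to the spans and
    to their closures. *)

Local Notation dlt n := ((n.+1%:R)^-1).

(** * Convergence in a C*-algebra *)

Section Convergence.
Variables (R : realType) (A : cstarAlgType R).
Implicit Types (a b : nat -> A) (l m x y z : A) (S : set A).

Lemma cnormN x : cnorm (- x) = cnorm x.
Proof. by apply: complexI; rewrite -scaleN1r cnormZ normrN1 mul1r. Qed.

Lemma cnormB x y : cnorm (x - y) = cnorm (y - x).
Proof. by rewrite -cnormN opprB. Qed.

Lemma cnorm_tri y x z : cnorm (x - z) <= cnorm (x - y) + cnorm (y - z).
Proof. by apply: le_trans (cnormD _ _); rewrite addrA subrK. Qed.

Lemma cnorm_le_dist x y : cnorm x <= cnorm y + cnorm (x - y).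
Proof. by apply: le_trans (cnormD _ _); rewrite addrC subrK. Qed.

Lemma cnormZr (c : R) x : 0 <= c -> cnorm (c%:C *: x) = c * cnorm x.
Proof. by move=> c0; apply: complexI; rewrite cnormZ ger0_norm ?lecR // rmorphM. Qed.

Lemma cnorm1 : cnorm (1 : A) = 1.
Proof.
have := cnorm_star (1 : A); rewrite star1 mul1r => /eqP.
rewrite expr2 -subr_eq0 -{1}[cnorm 1]mulr1 -mulrBr mulf_eq0 subr_eq0.
move=> /orP[/eqP h|/eqP <- //].
by have := oner_neq0 A; rewrite (cnorm0_eq0 _ h) eqxx.
Qed.

Lemma cnorm_alg (c : R[i]) : (cnorm (c%:A : A))%:C = `|c|.
Proof. by rewrite cnormZ cnorm1 mulr1. Qed.

Lemma starB x y : star (x - y) = star x - star y.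
Proof. by rewrite starD -scaleN1r starZ rmorphN1 scaleN1r. Qed.

(** Convergence at the rate 1/(n+1).  Every point of a closure is reached at this
    rate, the rate is preserved by the algebra operations, and fixing it replaces
    the choice of thresholds by the choice of one constant. *)
Definition rcvg a l := exists2 K : R, 0 <= K & forall n, cnorm (a n - l) <= K * dlt n.

Let dlt0 n : 0 < dlt n :> R. Proof. exact: dlt_gt0. Qed.
Let dlt1 n : dlt n <= 1 :> R. Proof. by rewrite invf_le1 ?ltr0n // ler1n. Qed.

Lemma rcvg_cst l : rcvg (fun=> l) l.
Proof. by exists 0 => // n; rewrite subrr cnorm0 mul0r. Qed.

Lemma rcvgD a b l m : rcvg a l -> rcvg b m -> rcvg (fun n => a n + b n) (l + m).
Proof.
move=> [K K0 hK] [L L0 hL]; exists (K + L) => [|n]; first exact: addr_ge0.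
by rewrite opprD addrACA mulrDl; apply: le_trans (cnormD _ _) _; exact: lerD.
Qed.

Lemma rcvgM a b l m : rcvg a l -> rcvg b m -> rcvg (fun n => a n * b n) (l * m).
Proof.
move=> [K K0 hK] [L L0 hL].
have l0 := cnorm_ge0 l; have m0 := cnorm_ge0 m.
exists (K * (cnorm m + L) + cnorm l * L) => [|n].
  by rewrite addr_ge0 ?mulr_ge0 ?addr_ge0.
have -> : a n * b n - l * m = (a n - l) * b n + l * (b n - m).
  by rewrite mulrBl mulrBr addrA subrK.
apply: le_trans (cnormD _ _) _; rewrite [leRHS]mulrDl; apply: lerD.
  apply: le_trans (cnormM _ _) _; rewrite mulrAC.
  apply: ler_pM; rewrite ?cnorm_ge0 //.
  apply: le_trans (cnorm_le_dist _ m) (lerD _ _) => //.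
  by apply: le_trans (hL n) _; rewrite ler_piMr.
by apply: le_trans (cnormM _ _) _; rewrite -mulrA ler_wpM2l.
Qed.

Lemma rcvgZ (c : R[i]) a l : rcvg a l -> rcvg (fun n => c *: a n) (c *: l).
Proof.
move=> h; have := rcvgM (rcvg_cst c%:A) h; rewrite mulr_algl.
by under eq_fun do rewrite mulr_algl.
Qed.

Lemma rcvg_star a l : rcvg a l -> rcvg (fun n => star (a n)) (star l).
Proof.
by move=> [K K0 hK]; exists K => // n; rewrite -starB cnorm_starE.
Qed.

Lemma rcvg_sum (I : Type) (r : seq I) (a : I -> nat -> A) (l : I -> A) :
  (forall i, rcvg (a i) (l i)) ->
  rcvg (fun n => \sum_(i <- r) a i n) (\sum_(i <- r) l i).
Proof.
move=> h; elim: r => [|i r IH].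
  by rewrite big_nil; under eq_fun do rewrite big_nil; apply: rcvg_cst.
by rewrite big_cons; under eq_fun do rewrite big_cons; apply: rcvgD.
Qed.

Lemma rcvg_unique a l m : rcvg a l -> rcvg a m -> l = m.
Proof.
move=> [K K0 hK] [L L0 hL]; apply/eqP; rewrite -subr_eq0; apply/eqP/cnorm0_eq0/eqP.
rewrite eq_le cnorm_ge0 andbT; apply: (@le_dlt _ _ _ (K + L)) => [|n].
  exact: addr_ge0.
by rewrite add0r mulrDl (le_trans (cnorm_tri (a n) _ _)) // lerD // cnormB.
Qed.

Lemma rcvg_exists a (K : R) : 0 <= K ->
  (forall n k : nat, (n <= k)%N -> cnorm (a k - a n) <= K * dlt n) -> exists l, rcvg a l.
Proof.
move=> K0 ha.
have [e e0|l hl] := @cnorm_complete _ A a.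
  have K1 : 0 < 2 * (K + 1) by lra.
  have [N hN] := dlt_lt (divr_gt0 e0 K1).
  exists N => k n Nk Nn; apply: le_lt_trans (cnorm_tri (a N) _ _) _.
  have := ha _ _ Nk; have := ha _ _ Nn; rewrite [cnorm (a n - _)]cnormB.
  have := hN N (leqnn _); rewrite ltr_pdivlMr //; have := dlt0 N.
  by move: (dlt N) (cnorm _) (cnorm _) => d x y; nra.
exists l, K => // n; apply/ler_addgt0Pl => e e0.
have [N hN] := hl e e0.
have := hN (maxn n N) (leq_maxr _ _); have := ha n (maxn n N) (leq_maxl _ _).
have := cnorm_tri (a (maxn n N)) (a n) l; rewrite [cnorm (a n - a _)]cnormB.
move: (cnorm _) (cnorm _) (cnorm _) (K / _) => x y z d; lra.
Qed.

Lemma nclosureP S l : nclosure S l <-> exists2 a, (forall n, S (a n)) & rcvg a l.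
Proof.
split=> [h|[a Sa [K K0 hK]] e e0].
  have /choice[a ha] n : exists x, S x /\ cnorm (x - l) <= 1 * dlt n.
    have [x Sx hx] := h _ (dlt0 n); exists x; split=> //.
    by rewrite mul1r cnormB ltW.
  by exists a => [n|]; [case: (ha n)|exists 1 => // n; case: (ha n)].
have K1 : 0 < K + 1 by lra.
have [N hN] := dlt_lt (divr_gt0 e0 K1).
exists (a N) => //; rewrite cnormB; apply: le_lt_trans (hK N) _.
have := hN N (leqnn _); rewrite ltr_pdivlMr //; have := dlt0 N.
by move: (dlt N) => d; nra.
Qed.

Lemma nclosure_idem S : (nclosure (nclosure S) `<=` nclosure S)%classic.
Proof.
move=> x h e e0; have e1 : 0 < e / 2 by lra.
have [y hy xy] := h _ e1; have [z Sz yz] := hy _ e1.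
by exists z => //; have := cnorm_tri y x z; move: xy yz; lra.
Qed.

End Convergence.

(** * Square roots in matrix algebras *)

Section SquareRoot.
Variables (R : realType) (A : cstarAlgType R) (n : nat).
Implicit Types (M N T Y : 'M[A]_n).

(** Scaling by a complex number; the module structure of ['M[A]_n] only offers
    left multiplication by an element of A. *)
Definition cscale (c : R[i]) M : 'M[A]_n := map_mx ( *:%R c) M.

Lemma cscaleE c M i j : cscale c M i j = c *: M i j.
Proof. by rewrite mxE. Qed.

Lemma cscaleMl c M N : cscale c M *m N = cscale c (M *m N).
Proof.
apply/matrixP => i j; rewrite !mxE scaler_sumr.
by apply: eq_bigr => k _; rewrite mxE scalerAl.
Qed.

Lemma cscaleMr c M N : M *m cscale c N = cscale c (M *m N).
Proof.
apply/matrixP => i j; rewrite !mxE scaler_sumr.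
by apply: eq_bigr => k _; rewrite mxE scalerAr.
Qed.

Lemma cscaleA c d M : cscale c (cscale d M) = cscale (c * d) M.
Proof. by apply/matrixP => i j; rewrite !mxE scalerA. Qed.

Lemma cscale1 M : cscale 1 M = M.
Proof. by apply/matrixP => i j; rewrite mxE scale1r. Qed.

Lemma cscaleB c M N : cscale c (M - N) = cscale c M - cscale c N.
Proof. by apply/matrixP => i j; rewrite !mxE scalerBr. Qed.

Lemma adjmxE M i j : adjmx M i j = star (M j i).
Proof. by rewrite !mxE. Qed.

Lemma adjmx_cscale c M : adjmx (cscale c M) = cscale c^* (adjmx M).
Proof. by apply/matrixP => i j; rewrite !mxE starZ. Qed.

Lemma adjmxK : involutive (@adjmx R A n).
Proof. by move=> M; apply/matrixP => i j; rewrite !mxE starK. Qed.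

Lemma adjmxD M N : adjmx (M + N) = adjmx M + adjmx N.
Proof. by apply/matrixP => i j; rewrite !mxE starD. Qed.

Lemma adjmxB M N : adjmx (M - N) = adjmx M - adjmx N.
Proof. by apply/matrixP => i j; rewrite !mxE starB. Qed.

Lemma star_sum (I : finType) (F : I -> A) : star (\sum_i F i) = \sum_i star (F i).
Proof. exact: (big_morph _ (@starD _ _) (star0 A)). Qed.

Lemma adjmxM M N : adjmx (M *m N) = adjmx N *m adjmx M.
Proof.
apply/matrixP => i j; rewrite !mxE star_sum.
by apply: eq_bigr => k _; rewrite !mxE starM.
Qed.

Lemma adjmx1 : adjmx (1%:M : 'M[A]_n) = 1%:M.
Proof.
by apply/matrixP => i j; rewrite !mxE eq_sym; case: eqP; rewrite ?star1 ?star0.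
Qed.

(** [poscomb T M r] says that M = p(T) for a polynomial p with nonnegative
    coefficients of sum r = p(1).  The pair (M, r) is all that the norm estimate
    uses, and keeping p implicit avoids evaluating polynomials in M_n(A). *)
Inductive poscomb T : 'M[A]_n -> R -> Prop :=
| poscomb_exp k : poscomb T (T ^+ k) 1
| poscombD M N r s : poscomb T M r -> poscomb T N s -> poscomb T (M + N) (r + s)
| poscombZ c M r : 0 <= c -> poscomb T M r -> poscomb T (cscale c%:C M) (c * r).

Lemma poscomb0 T : poscomb T 0 0.
Proof.
have := poscombZ (lexx 0) (poscomb_exp T 0); rewrite mul0r.
suff -> : cscale 0%:C (T ^+ 0) = 0 by [].
by apply/matrixP => i j; rewrite cscaleE scale0r mxE.
Qed.

Lemma poscombM T M N r s : poscomb T M r -> poscomb T N s -> poscomb T (M *m N) (r * s).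
Proof.
move=> hM hN; elim: hM => [k|M1 M2 r1 r2 _ h1 _ h2|c M1 r1 c0 _ h1].
- elim: hN => [l|N1 N2 r1 r2 _ h1 _ h2|c N1 r1 c0 _ h1].
  + by rewrite mulr1 mulmxE -exprD; apply: poscomb_exp.
  + by rewrite mulmxDr mulrDr; apply: poscombD.
  + by rewrite cscaleMr mulrCA; apply: poscombZ.
- by rewrite mulmxDl mulrDl; apply: poscombD.
- by rewrite cscaleMl -mulrA; apply: poscombZ.
Qed.

Lemma poscomb_le T M r : (forall k i j, cnorm ((T ^+ k) i j) <= 1) ->
  poscomb T M r -> forall i j, cnorm (M i j) <= r.
Proof.
move=> hT; elim=> [k|M1 M2 r1 r2 _ h1 _ h2|c M1 r1 c0 _ h1] i j //.
  by rewrite mxE; apply: le_trans (cnormD _ _) _; exact: lerD.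
by rewrite cscaleE cnormZr // ler_wpM2l.
Qed.

(** Visser's iteration Y' = (T + Y^2)/2.  A fixed point Y satisfies
    (1 - Y)^2 = 1 - T. *)
Fixpoint visser T k : 'M[A]_n :=
  if k is k'.+1 then cscale 2^-1%:C (T + visser T k' *m visser T k') else 0.

(** The value at T = 1 of the polynomials of Visser's iteration, i.e. the sum of
    their coefficients; it increases to 1. *)
Fixpoint visser_sum k : R :=
  if k is k'.+1 then 2^-1 * (1 + visser_sum k' * visser_sum k') else 0.

(** The defect d = 1 - y obeys d' = d - d^2/2, which makes it decay like 2/k. *)
Lemma visser_sum_bnd k : 0 <= visser_sum k <= 1 /\ 1 - visser_sum k <= 2 / k.+2%:R.
Proof.
elim: k => [|k [/andP[IH0 IH1] IH]] /=.
  by split; [rewrite lexx ler01|lra].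
split; first by apply/andP; split; nra.
move: IH; rewrite -(addn3 k) -(addn2 k) (natrD _ k 2) (natrD _ k 3).
set x : R := k%:R; have x0 : 0 <= x by rewrite /x ler0n.
move: (visser_sum k) IH0 IH1 => y y0 y1; rewrite !ler_pdivlMr; [|lra|lra] => h.
suff : (1 - y) * (1 + y) * (x + 3) <= 4 by lra.
have x2 : 0 < (x + 2) ^+ 2 by rewrite exprn_gt0 //; lra.
rewrite -(ler_pM2l x2).
have -> : (x + 2) ^+ 2 * ((1 - y) * (1 + y) * (x + 3)) =
  ((1 - y) * (x + 2)) * (2 * (x + 2) - (1 - y) * (x + 2)) * (x + 3) by ring.
have : 0 <= (1 - y) * (x + 2) by rewrite mulr_ge0 //; lra.
move: (_ * _) h => p p2 p0.
have h1 : p * (2 * (x + 2) - p) <= 4 * (x + 1) by nra.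
nra.
Qed.

(** The increments again have nonnegative coefficients, because
    Y'^2 - Y^2 = Y' (Y' - Y) + (Y' - Y) Y. *)
Lemma visser_step T k :
  poscomb T (visser T k) (visser_sum k) /\
  poscomb T (visser T k.+1 - visser T k) (visser_sum k.+1 - visser_sum k).
Proof.
have h0 : 0 <= 2^-1 :> R by lra.
have hT : poscomb T T 1 by rewrite -{2}[T]expr1; apply: poscomb_exp.
elim: k => [|k [IH1 IH2]].
  split; first exact: poscomb0.
  rewrite /= mul0mx !subr0 mulr0 !addr0; exact: poscombZ.
have IH3 : poscomb T (visser T k.+1) (visser_sum k.+1).
  rewrite -[visser T _](subrK (visser T k)) -[visser_sum _](subrK (visser_sum k)).
  exact: poscombD.
split=> //.
have -> : visser T k.+2 - visser T k.+1 = cscale 2^-1%:C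
   (visser T k.+1 *m (visser T k.+1 - visser T k) +
    (visser T k.+1 - visser T k) *m visser T k).
  rewrite [visser T k.+2]/= -/(visser T k.+1) {3}/visser -/visser.
  rewrite -cscaleB opprD addrACA subrr add0r.
  by rewrite mulmxBr mulmxBl addrA subrK.
have -> : visser_sum k.+2 - visser_sum k.+1 = 2^-1 *
   (visser_sum k.+1 * (visser_sum k.+1 - visser_sum k) +
    (visser_sum k.+1 - visser_sum k) * visser_sum k).
  by rewrite [visser_sum k.+2]/= -/(visser_sum k.+1) {3}/visser_sum -/visser_sum; ring.
by apply: poscombZ => //; apply: poscombD; apply: poscombM.
Qed.

Lemma visser_cauchy T k l : (k <= l)%N ->
  poscomb T (visser T l - visser T k) (visser_sum l - visser_sum k).
Proof.
move=> /subnK <-; elim: (l - k)%N => [|m IH].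
  by rewrite add0n !subrr; apply: poscomb0.
rewrite addSn -[visser T _](subrK (visser T (m + k))) -addrA.
rewrite -[visser_sum _](subrK (visser_sum (m + k))) -[_ + _ - visser_sum k]addrA.
by apply: poscombD => //; case: (visser_step T (m + k)).
Qed.

Lemma visser_adj T k : adjmx T = T -> adjmx (visser T k) = visser T k.
Proof.
move=> hT; elim: k => [|k IH] /=; first by apply/matrixP => i j; rewrite !mxE star0.
by rewrite adjmx_cscale adjmxD adjmxM hT IH conjc_real.
Qed.

(** A bound on entries makes sense without choosing a norm on M_n(A), and by
    [poscomb_le] it makes the iterates Cauchy entrywise, at the speed of the real
    sequence [visser_sum].  If Z is their limit, the square root is 1 - Z. *)
Lemma sqrt_1B T : adjmx T = T -> (forall k i j, cnorm ((T ^+ k) i j) <= 1) ->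
  exists2 Y, adjmx Y = Y & Y *m Y = 1%:M - T.
Proof.
move=> sT hT.
have /choice[Y hY] (ij : 'I_n * 'I_n) : exists l, rcvg (fun k => visser T k ij.1 ij.2) l.
  apply: (@rcvg_exists _ _ _ 2) => // k l kl.
  have := poscomb_le hT (visser_cauchy T kl) ij.1 ij.2; rewrite !mxE => /le_trans; apply.
  have [/andP[_ h1] _] := visser_sum_bnd l; have [_ h2] := visser_sum_bnd k.
  have : 2 / k.+2%:R <= 2 / k.+1%:R :> R.
    by rewrite ler_pM2l // lef_pV2 ?posrE ?ltr0n // ler_nat.
  by move: (2 / _) (2 / _) h2 => x y; lra.
pose Z : 'M[A]_n := \matrix_(i, j) Y (i, j).
have {}hY i j : rcvg (fun k => visser T k i j) (Z i j) by rewrite mxE; apply: (hY (i, j)).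
have sZ : adjmx Z = Z.
  apply/matrixP => i j; rewrite adjmxE.
  apply: (@rcvg_unique _ _ (fun k => visser T k i j)); last exact: (hY i j).
  have := rcvg_star (hY j i); congr rcvg; apply/funext => k.
  by rewrite -adjmxE visser_adj.
have Z2 : cscale 2%:C Z = T + Z *m Z.
  apply/matrixP => i j; rewrite cscaleE [RHS]mxE [X in _ + X]mxE.
  apply: (@rcvg_unique _ _ (fun k => 2%:C *: visser T k.+1 i j)).
    apply: rcvgZ; have [K K0 hK] := hY i j; exists K => // k.
    apply: le_trans (hK _) _; rewrite ler_wpM2l // lef_pV2 ?posrE ?ltr0n // ler_nat.
    exact: leqW.
  have : rcvg (fun k => T i j + \sum_l visser T k i l * visser T k l j)
     (T i j + \sum_l Z i l * Z l j).
    by apply: rcvgD; [exact: rcvg_cst|apply: rcvg_sum => l; apply: rcvgM].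
  congr rcvg; apply/funext => k /=.
  rewrite cscaleE scalerA -rmorphM mulfV ?pnatr_eq0 // rmorph1 scale1r.
  by rewrite mxE; congr (_ + _); rewrite mxE.
exists (1%:M - Z); first by rewrite adjmxB adjmx1 sZ.
rewrite mulmxBl mulmxBr mul1mx mulmxBr mulmx1 mul1mx.
have -> : T = cscale 2%:C Z - Z *m Z by rewrite Z2 addrK.
have -> : cscale 2%:C Z = Z + Z.
  by apply/matrixP => i j; rewrite !mxE -[2]/(1 + 1) rmorphD scalerDl !scale1r.
by rewrite !opprD !opprK !addrA.
Qed.

End SquareRoot.

(** * Contractivity of *-homomorphisms *)

Section Contractive.
Variables (R : realType) (A : cstarAlgType R) (H : sepHilbertType R).
Variable f : {lrmorphism A -> bop H}.
Hypothesis f_star : {morph f : a / star a}.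

Lemma cnormX (a : A) k : cnorm a <= 1 -> cnorm (a ^+ k) <= 1.
Proof.
move=> a1; elim: k => [|k IH]; first by rewrite expr0 cnorm1.
by rewrite exprS; apply: le_trans (cnormM _ _) _; rewrite mulr_ile1 ?cnorm_ge0.
Qed.

(** If a is in the unit ball then 1 - (star a) a = (star y) y, so that the
    squared norm of x exceeds that of f a x by the squared norm of f y x. *)
Lemma morph_contractive_unit (a : A) : cnorm a <= 1 -> cnorm (f a) <= 1.
Proof.
move=> a1; pose b := star a * a; pose T : 'M[A]_1 := b%:M.
have sb : star b = b by rewrite starM starK.
have b1 : cnorm b <= 1 by rewrite cnorm_star expr_le1 ?cnorm_ge0.
have TX k : T ^+ k = (b ^+ k)%:M.
  by elim: k => [|k IH]; rewrite ?expr0 // exprS IH exprS /T -mulmxE -scalar_mxM.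
have [||Y sY hY] := @sqrt_1B _ _ _ T.
- by apply/matrixP => i j; rewrite adjmxE !ord1 !mxE sb.
- by move=> k i j; rewrite TX !ord1 mxE mulr1n cnormX.
pose y := Y 0 0.
have sy : star y = y by rewrite /y -{2}sY adjmxE.
have yy : star y * y = 1 - b.
  rewrite sy; have /matrixP/(_ 0 0) := hY.
  by rewrite !mxE big_ord1 !mulr1n.
apply: opnorm_le => // x; rewrite mul1r.
have fE c : (nrm (f c x) ^+ 2)%:C = inner x (f (star c * c) x).
  have -> : f (star c * c) = adjoint (f c) * f c by rewrite rmorphM /= f_star.
  by rewrite -inner_nrm adjointP.
rewrite -ler_sqr ?nnegrE ?nrm_ge0 // -lecR fE -/b -inner_nrm -subr_ge0.
suff -> : inner x x - inner x (f b x) = (nrm (f y x) ^+ 2)%:C by rewrite lecR sqr_ge0.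
by rewrite fE yy rmorphB rmorph1 -[(1 - f b) x]/(x - f b x) linearBr.
Qed.

Lemma morph_contractive (a : A) : cnorm (f a) <= cnorm a.
Proof.
have [a0|a0] := eqVneq (cnorm a) 0.
  by rewrite (cnorm0_eq0 _ a0) raddf0 !cnorm0.
have a1 : 0 < cnorm a by rewrite lt_neqAle eq_sym a0 cnorm_ge0.
have := @morph_contractive_unit ((cnorm a)^-1%:C *: a).
rewrite linearZ /= !cnormZr ?invr_ge0 ?cnorm_ge0 // mulVf // => /(_ (lexx _)).
by rewrite ler_pdivrMl // mulr1.
Qed.

End Contractive.

(** * The tower of finite spin algebras *)

Section Tower.
Variables (R : realType) (A : cstarAlgType R) (u : nat -> A).
Hypothesis u_spin : spin_relations u.
Implicit Types (a b c : A) (i j k m : nat).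

(** The algebra generated by u 0, ..., u (m-1).  The decomposition into two
    components a + c u_m turns the algebraic closure properties, as well as the
    norm bound, into inductions on m. *)
Fixpoint tower m : set A :=
  if m is m'.+1
  then [set x | exists a c, [/\ tower m' a, tower m' c & x = a + c * u m']]
  else [set x | exists c : R[i], x = c%:A].

Let u_sa k : star (u k) = u k. Proof. by case: u_spin. Qed.
Let uu k : u k * u k = 1. Proof. by case: u_spin => _ h _; rewrite -expr2. Qed.
Let uKr k a : a * u k * u k = a. Proof. by rewrite -mulrA uu mulr1. Qed.
Let u_anti i j : i != j -> u i * u j = - (u j * u i).
Proof. by case: u_spin => _ _ h /h/eqP; rewrite addr_eq0 => /eqP. Qed.

Lemma tower_linear m (z : R[i]) a b : tower m a -> tower m b -> tower m (z *: a + b).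
Proof.
elim: m a b => [|m IH] p q /=.
  by move=> [x ->] [y ->]; exists (z * x + y); rewrite scalerDl scalerA.
move=> [a [c [ha hc ->]]] [a' [c' [ha' hc' ->]]].
exists (z *: a + a'), (z *: c + c'); split; try exact: IH.
by rewrite scalerDr addrACA mulrDl scalerAl.
Qed.

Lemma tower_scalar m (z : R[i]) : tower m z%:A.
Proof.
elim: m z => [|m IH] z /=; first by exists z.
by exists z%:A, 0%:A; split=> //; rewrite scale0r mul0r addr0.
Qed.

Lemma tower0 m : tower m 0.
Proof. by rewrite -(scale0r 1); apply: tower_scalar. Qed.

Lemma tower1 m : tower m 1.
Proof. by rewrite -(scale1r 1); apply: tower_scalar. Qed.

Lemma towerD m a b : tower m a -> tower m b -> tower m (a + b).
Proof. by move=> ha; rewrite -{1}(scale1r a); apply: tower_linear. Qed.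

Lemma towerN m a : tower m a -> tower m (- a).
Proof.
by move=> ha; rewrite -[- a]addr0 -scaleN1r; apply: tower_linear => //; apply: tower0.
Qed.

Lemma tower_widen m k a : (m <= k)%N -> tower m a -> tower k a.
Proof.
move=> /subnK <- ha; elim: (k - m)%N => [//|l IH].
by rewrite addSn; exists a, 0; split; rewrite ?mul0r ?addr0 //; apply: tower0.
Qed.

Lemma tower_gen k : tower k.+1 (u k).
Proof. by exists 0, 1; rewrite add0r mul1r; split=> //; [apply: tower0|apply: tower1]. Qed.

Lemma tower_conj m j a : (m <= j)%N -> tower m a -> tower m (u j * a * u j).
Proof.
elim: m a => [|m IH] p mj /=.
  by move=> [z ->]; exists z; rewrite mulr_algr -scalerAl uu.
move=> [a [c [ha hc ->]]].
exists (u j * a * u j), (- (u j * c * u j)); split; first exact/IH/ha/ltnW.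
  exact/towerN/IH/hc/ltnW.
rewrite mulrDr mulrDl; congr (_ + _).
by rewrite !mulrA -mulrA [u m * _]u_anti ?ltn_eqF // mulrN mulNr !mulrA.
Qed.

Lemma tower_conjr m a : tower m a -> exists2 a', tower m a' & u m * a = a' * u m.
Proof.
by move=> ha; exists (u m * a * u m); [apply: tower_conj|rewrite uKr].
Qed.

Lemma towerM m a b : tower m a -> tower m b -> tower m (a * b).
Proof.
elim: m a b => [|m IH] p q /=.
  by move=> [x ->] [y ->]; exists (x * y); rewrite mulr_algl scalerA.
move=> [a [c [ha hc ->]]] [a' [c' [ha' hc' ->]]].
have [a1 ha1 ea] := tower_conjr ha'; have [c1 hc1 ec] := tower_conjr hc'.
exists (a * a' + c * c1), (a * c' + c * a1); split.
- by apply: towerD; apply: IH.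
- by apply: towerD; apply: IH.
rewrite mulrDl !mulrDr -[c * u m * a']mulrA ea.
have -> : c * u m * (c' * u m) = c * c1.
  by rewrite -[c * u m * _]mulrA [u m * _]mulrA ec uKr.
by rewrite mulrDl !mulrA -!addrA; congr (_ + _); rewrite addrA addrC.
Qed.

Lemma tower_star m a : tower m a -> tower m (star a).
Proof.
elim: m a => [|m IH] p /=.
  by move=> [z ->]; exists z^*; rewrite starZ star1.
move=> [a [c [ha hc ->]]].
have [c1 hc1 ec] := tower_conjr (IH _ hc).
exists (star a), c1; split=> //; first exact: IH.
by rewrite starD starM u_sa ec.
Qed.

(** Moving u_i u_j past a generator of smaller index changes the sign twice. *)
Lemma tower_comm m i j a : i != j -> (m <= i)%N -> (m <= j)%N -> tower m a ->
  u i * u j * a = a * (u i * u j).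
Proof.
move=> ij; elim: m a => [|m IH] p mi mj /=.
  by move=> [z ->]; rewrite mulr_algr mulr_algl.
move=> [a [c [ha hc ->]]].
have {}IH b : tower m b -> u i * u j * b = b * (u i * u j) by apply: IH; apply: ltnW.
rewrite mulrDr mulrDl IH //; congr (_ + _).
rewrite mulrA IH // -!mulrA; congr (_ * _).
rewrite [u j * u m]u_anti ?gtn_eqF // mulrN !mulrA.
by rewrite [u i * u m]u_anti ?gtn_eqF // mulNr opprK.
Qed.

Lemma cnorm_gen k : cnorm (u k) = 1.
Proof.
have := cnorm_star (u k); rewrite u_sa uu cnorm1 => /esym/eqP.
by rewrite sqrp_eq1 ?cnorm_ge0 // => /eqP.
Qed.

Lemma tower_dense : cstar_generated u -> forall a,
  nclosure [set x | exists m, tower m x] a.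
Proof.
pose S := [set x | exists m, tower m x]%classic.
have S2 (P : A -> A -> A) : (forall m a b, tower m a -> tower m b -> tower m (P a b)) ->
    forall a b, S a -> S b -> S (P a b).
  move=> hP a b [k ha] [l hb]; exists (maxn k l); apply: hP.
    exact: tower_widen (leq_maxl _ _) ha.
  exact: tower_widen (leq_maxr _ _) hb.
have Sos : operator_system S.
  split; first by exists 0%N; apply: tower1.
    by move=> a [m ha]; exists m; apply: tower_star.
  by move=> z; apply: (S2 (fun a b => z *: a + b)) => m a b; apply: tower_linear.
move=> gen; suff -> : nclosure S = setT by [].
apply: gen.
  split; first exact: (nclosure_operator_system (OpSys Sos)).
    move=> a b /nclosureP[x Sx xa] /nclosureP[y Sy yb]; apply/nclosureP.
    exists (fun n => x n * y n) => [n|]; last exact: rcvgM.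
    by apply: (S2 *%R) => // m c d; apply: towerM.
  exact: nclosure_idem.
move=> _ [k _ <-]; apply/nclosureP; exists (fun=> u k) => [_|]; last exact: rcvg_cst.
by exists k.+1; apply: tower_gen.
Qed.

Variables (B : cstarAlgType R) (f : {lrmorphism A -> B}).
Hypothesis fu : forall k, cnorm (f (u k)) = 1.

Lemma cnorm_morph_mulgen a k : cnorm (f (a * u k)) <= cnorm (f a).
Proof. by rewrite rmorphM; apply: le_trans (cnormM _ _) _; rewrite fu mulr1. Qed.

Lemma cnorm_morph_genmul a k : cnorm (f (u k * a)) <= cnorm (f a).
Proof. by rewrite rmorphM; apply: le_trans (cnormM _ _) _; rewrite fu mul1r. Qed.

(** The constant 3 comes from b = a + c u_m, whose components satisfy
    |f a| <= |f b| and |f c| = |f (b - a)| <= 2 |f b|. *)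
Lemma tower_bound m b : tower m b -> cnorm b <= 3 ^+ m * cnorm (f b).
Proof.
elim: m b => [|m IH] p /=.
  move=> [z ->]; rewrite expr0 mul1r.
  suff -> : cnorm (f z%:A) = cnorm (z%:A : A) by [].
  by rewrite linearZ rmorph1; apply: complexI; rewrite !cnorm_alg.
move=> [a [c [ha hc ->]]].
set b := a + c * u m; pose w := u m.+1.
have mm : m.+1 != m by rewrite gtn_eqF.
(* w u_m is the adjoint of s = u_m w, so the left side is s b (star s) *)
have sbs : u m * w * b * w * u m = a - c * u m.
  have comm d : tower m d -> u m * w * d = d * (u m * w).
    by apply: tower_comm => //; rewrite eq_sym.
  suff -> : u m * w * b = (a - c * u m) * (u m * w) by rewrite !mulrA !uKr.
  rewrite mulrDr mulrDl (comm _ ha) [X in _ + X = _]mulrA (comm _ hc) -!mulrA; congr (_ + _).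
  by rewrite [w * u m]u_anti // mulNr !mulrN !mulrA.
have fa : cnorm (f a) <= cnorm (f b).
  have -> : a = 2^-1%:C *: (b + u m * w * b * w * u m).
    have -> : b + u m * w * b * w * u m = 2%:C *: a.
      rewrite sbs /b addrACA subrr addr0.
      by rewrite -[2]/(1 + 1) rmorphD scalerDl !scale1r.
    by rewrite scalerA -rmorphM mulVf ?pnatr_eq0 // rmorph1 scale1r.
  rewrite linearZ /= cnormZr; last by lra.
  rewrite rmorphD; have := cnormD (f b) (f (u m * w * b * w * u m)).
  have : cnorm (f (u m * w * b * w * u m)) <= cnorm (f b).
    do 2![apply: le_trans (cnorm_morph_mulgen _ _) _]; rewrite -mulrA.
    by do 2![apply: le_trans (cnorm_morph_genmul _ _) _].
  by lra.
have fc : cnorm (f c) <= 2 * cnorm (f b).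
  rewrite -{1}(uKr m c); apply: le_trans (cnorm_morph_mulgen _ _) _.
  have -> : c * u m = b - a by rewrite /b addrAC subrr add0r.
  rewrite rmorphB; apply: le_trans (cnormD _ _) _; rewrite cnormN; lra.
have := cnormD a (c * u m); have := cnormM c (u m); rewrite cnorm_gen mulr1.
have := IH _ ha; have := IH _ hc; rewrite exprS.
have : 0 <= 3 ^+ m :> R by rewrite exprn_ge0.
move: (3 ^+ m) => K; rewrite -/b => K0.
move: (cnorm (c * u m)) (cnorm a) (cnorm b) (cnorm c) => x1 x2 x3 x4 h1 h2 h3 h4.
have h5 := ler_wpM2l K0 fa; have h6 := ler_wpM2l K0 fc; lra.
Qed.

End Tower.

(** * Isometry *)

Section Isometry.
Variable R : realType.

(** The constant K disappears in the limit of the 2^k-th roots; Bernoulli's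
    inequality applied to x/y > 1 avoids taking roots. *)
Lemma le_of_pow2_bound (x y K : R) : 0 <= y ->
  (forall k, x ^+ (2 ^ k) <= K * y ^+ (2 ^ k)) -> x <= y.
Proof.
rewrite le_eqVlt => /predU1P[<- /(_ 0%N)|y0 h].
  by rewrite !expr1 mulr0.
rewrite leNgt; apply/negP => yx.
pose t := x / y - 1.
have t0 : 0 < t by rewrite subr_gt0 ltr_pdivlMr // mul1r.
have bern n : n%:R * t <= (x / y) ^+ n.
  have -> : x / y = 1 + t by rewrite /t addrC subrK.
  suff : 1 + n%:R * t <= (1 + t) ^+ n by lra.
  elim: n => [|n IH]; first by rewrite expr0 mul0r addr0.
  rewrite exprS -natr1.
  have n0 : 0 <= n%:R :> R by rewrite ler0n.
  move: (_ ^+ n) (n%:R : R) n0 IH => p q q0; nra.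
have hK k : (2 ^ k)%:R * t <= K.
  apply: le_trans (bern _) _; rewrite expr_div_n ler_pdivrMr ?exprn_gt0 //.
have [n] : exists n : nat, K / t < n%:R by exists (Num.truncn (K / t)).+1; exact: truncnS_gt.
rewrite ltr_pdivrMr // => hn.
have := hK n; apply/negP; rewrite -ltNge; apply: lt_trans hn _.
by rewrite ltr_pM2r // ltr_nat ltn_expl.
Qed.

Lemma cnorm_pow2 (A : cstarAlgType R) (b : A) k : star b = b ->
  cnorm (b ^+ (2 ^ k)) = cnorm b ^+ (2 ^ k).
Proof.
elim: k b => [|k IH] b sb; first by rewrite !expr1.
rewrite expnS !exprM IH; first by rewrite expr2 -{1}sb cnorm_star.
by rewrite expr2 starM sb.
Qed.

Variables (A : cstarAlgType R) (u : nat -> A) (H : sepHilbertType R).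
Variable f : {lrmorphism A -> bop H}.
Hypothesis f_star : {morph f : a / star a}.
Hypotheses (u_spin : spin_relations u) (u_gen : cstar_generated u).

Let fu k : cnorm (f (u k)) = 1.
Proof.
have [sa sq _] := u_spin.
have := cnorm_star (f (u k)); rewrite -f_star sa -rmorphM -expr2 sq rmorph1 cnorm1.
by move/esym/eqP; rewrite sqrp_eq1 ?cnorm_ge0 // => /eqP.
Qed.

Lemma tower_isometric m b : tower u m b -> cnorm b <= cnorm (f b).
Proof.
move=> hb; rewrite -ler_sqr ?nnegrE ?cnorm_ge0 // -!cnorm_star -f_star -rmorphM /=.
set c := star b * b; have hc : tower u m c.
  by apply: towerM => //; apply: tower_star.
have sc : star c = c by rewrite starM starK.
apply: (@le_of_pow2_bound _ _ (3 ^+ m)) => [|k]; first exact: cnorm_ge0.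
rewrite -(cnorm_pow2 k sc) -cnorm_pow2; last by rewrite -f_star sc.
have -> : f c ^+ (2 ^ k) = f (c ^+ (2 ^ k)) by rewrite rmorphXn.
apply: (tower_bound u_spin fu).
elim: (2 ^ k)%N => [|l IH]; first by rewrite expr0; apply: tower1.
by rewrite exprS; apply: towerM.
Qed.

Lemma morph_isometric a : cnorm (f a) = cnorm a.
Proof.
apply/eqP; rewrite eq_le morph_contractive //=.
have /nclosureP[b hb [K K0 hK]] := tower_dense u_spin u_gen a.
apply: (@le_dlt _ _ _ (2 * K)) => [|n]; first lra.
have [m hm] := hb n.
have := cnorm_le_dist a (b n); have := tower_isometric hm.
have := cnorm_le_dist (f (b n)) (f a); rewrite -rmorphB.
have := morph_contractive f_star (b n - a); have := hK n.
rewrite [cnorm (a - _)]cnormB -mulrA; move: (K / _) => d.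
move: (cnorm _) (cnorm _) (cnorm _) (cnorm _) (cnorm _) (cnorm _) => *; lra.
Qed.

End Isometry.

(** * Matrices of operators acting on H^n *)

Section Amplification.
Variables (R : realType) (H : sepHilbertType R) (n : nat).
Implicit Types (Z W : 'M[bop H]_n) (x y : 'I_n -> H).

Definition amp Z x : 'I_n -> H := fun i => \sum_j Z i j (x j).

Definition amp_inner x y : R[i] := \sum_i inner (x i) (y i).

Definition amp_sqnorm x : R := \sum_i nrm (x i) ^+ 2.

Definition amp_contraction Z := forall x, amp_sqnorm (amp Z x) <= amp_sqnorm x.

Lemma bop_sumE (I : Type) (r : seq I) (F : I -> bop H) (z : H) :
  (\sum_(i <- r) F i) z = \sum_(i <- r) F i z.
Proof. by elim/big_rec2: _ => // i w S _ <-. Qed.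

Lemma ampM Z W x : amp (Z *m W) x = amp Z (amp W x).
Proof.
apply/funext => i; rewrite /amp.
under eq_bigr => j _ do rewrite mxE bop_sumE.
rewrite exchange_big /=; apply: eq_bigr => k _.
by rewrite linear_sum; apply: eq_bigr => j _.
Qed.

Lemma amp1 x : amp 1%:M x = x.
Proof.
apply/funext => i; rewrite /amp (bigD1 i) //= mxE eqxx bop1E big1 ?addr0 // => j ji.
by rewrite mxE eq_sym (negbTE ji).
Qed.

Lemma ampB Z W x : amp (Z - W) x = amp Z x - amp W x.
Proof.
apply/funext => i; rewrite fctE /amp -sumrB; apply: eq_bigr => j _.
by rewrite !mxE.
Qed.

Lemma amp_scale c Z x i : amp (cscale c Z) x i = c *: amp Z x i.
Proof. by rewrite /amp scaler_sumr; apply: eq_bigr => j _; rewrite cscaleE. Qed.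

Lemma amp_innerE x : amp_inner x x = (amp_sqnorm x)%:C.
Proof. by rewrite rmorph_sum; apply: eq_bigr => i _; rewrite inner_nrm. Qed.

Lemma amp_adj Z x y : amp_inner (amp Z x) y = amp_inner x (amp (adjmx Z) y).
Proof.
rewrite /amp_inner /amp; under eq_bigr do rewrite linear_sumlz /=.
rewrite exchange_big /=; apply: eq_bigr => j _; rewrite linear_sum /=.
by apply: eq_bigr => i _; rewrite adjmxE adjointP.
Qed.

Lemma amp_sqnorm_ge0 x : 0 <= amp_sqnorm x.
Proof. by apply: sumr_ge0 => i _; rewrite sqr_ge0. Qed.

Lemma le_amp_sqnorm x i : nrm (x i) ^+ 2 <= amp_sqnorm x.
Proof.
rewrite /amp_sqnorm (bigD1 i) //= lerDl.
by apply: sumr_ge0 => j _; rewrite sqr_ge0.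
Qed.

Lemma amp_sqnormB x y :
  amp_sqnorm (x - y) = amp_sqnorm x - 2 * complex.Re (amp_inner x y) + amp_sqnorm y.
Proof.
rewrite /amp_sqnorm /amp_inner raddf_sum mulr_sumr -sumrB -big_split /=.
apply: eq_bigr => i _.
have := nrm_expand (x i) (y i) (-1); rewrite rmorphN1 scaleN1r fctE => ->.
by ring.
Qed.

(** For w = (star Z) y, expand the squared norm of y - Z w: as |Z w| <= |w|, it is at
    most |y|^2 - |w|^2. *)
Lemma amp_contraction_adj Z : amp_contraction Z -> amp_contraction (adjmx Z).
Proof.
move=> cZ y.
have := amp_sqnorm_ge0 (y - amp Z (amp (adjmx Z) y)).
rewrite amp_sqnormB -{1}[Z]adjmxK -amp_adj amp_innerE /=.
by have := cZ (amp (adjmx Z) y); lra.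
Qed.

(** With Z' = star Z, |x - Z' Z x|^2 = |x|^2 - 2 |Z x|^2 + |Z' Z x|^2
    <= |x|^2 - |Z x|^2. *)
Lemma amp_contraction_1B Z : amp_contraction Z ->
  amp_contraction (1%:M - adjmx Z *m Z).
Proof.
move=> cZ x; rewrite ampB amp1 ampM amp_sqnormB -amp_adj amp_innerE /=.
have := amp_contraction_adj cZ (amp Z x); have := amp_sqnorm_ge0 (amp Z x); lra.
Qed.

Lemma amp_contractionX Z k : amp_contraction Z -> amp_contraction (Z ^+ k).
Proof.
move=> cZ; elim: k => [|k IH] x; first by rewrite expr0 amp1.
by rewrite exprS -mulmxE ampM; apply: le_trans (cZ _) (IH _).
Qed.

Lemma amp_contraction_entry Z i j : amp_contraction Z -> cnorm (Z i j) <= 1.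
Proof.
move=> cZ; apply: opnorm_le => // z; rewrite mul1r.
pose x : 'I_n -> H := fun k => if k == j then z else 0.
have Zx : amp Z x i = Z i j z.
  rewrite /amp (bigD1 j) //= /x eqxx big1 ?addr0 // => k /negbTE ->.
  by rewrite linear0.
have Qx : amp_sqnorm x = nrm z ^+ 2.
  rewrite /amp_sqnorm (bigD1 j) //= /x eqxx big1 ?addr0 // => k /negbTE ->.
  by rewrite nrm0 expr0n.
rewrite -ler_sqr ?nnegrE ?nrm_ge0 // -Qx -Zx.
exact: le_trans (le_amp_sqnorm _ _) (cZ x).
Qed.

Lemma amp_bounded Z : exists2 c : R, 0 < c & amp_contraction (cscale c^-1%:C Z).
Proof.
pose M := \sum_i \sum_j opnorm (Z i j).
have M0 i : 0 <= \sum_j opnorm (Z i j) by apply: sumr_ge0 => j _; apply: opnorm_ge0.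
have MM : 0 <= M by apply: sumr_ge0.
(* n M^2 <= (n M + 1)^2, so this c dominates sqrt n * M and is positive *)
pose c := n%:R * M + 1.
have c0 : 0 < c by rewrite /c ltr_wpDl // mulr_ge0 ?ler0n.
exists c => // x.
have entry i : nrm (amp Z x i) ^+ 2 <= M ^+ 2 * amp_sqnorm x.
  rewrite -[amp_sqnorm x]sqr_sqrtr ?amp_sqnorm_ge0 // -exprMn.
  rewrite ler_sqr ?nnegrE ?nrm_ge0 ?mulr_ge0 ?sqrtr_ge0 //.
  apply: (@le_trans _ _ (\sum_j opnorm (Z i j) * Num.sqrt (amp_sqnorm x))).
    rewrite /amp; elim/big_rec2: _ => [|j a b _ h]; first by rewrite nrm0.
    apply: le_trans (nrmD _ _) (lerD _ h).
    apply: le_trans (opnormP _ _) _; rewrite ler_wpM2l ?opnorm_ge0 //.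
    by rewrite -[nrm _]ger0_norm ?nrm_ge0 // -sqrtr_sqr ler_wsqrtr // le_amp_sqnorm.
  rewrite -mulr_suml ler_wpM2r ?sqrtr_ge0 // /M [leRHS](bigD1 i) //= lerDl.
  by apply: sumr_ge0.
have -> : amp_sqnorm (amp (cscale c^-1%:C Z) x) = c^-1 ^+ 2 * amp_sqnorm (amp Z x).
  rewrite /amp_sqnorm mulr_sumr; apply: eq_bigr => i _.
  by rewrite amp_scale nrmZr ?invr_ge0 ?(ltW c0) // exprMn.
rewrite exprVn ler_pdivrMl ?exprn_gt0 //.
apply: (@le_trans _ _ (n%:R * (M ^+ 2 * amp_sqnorm x))).
  rewrite /amp_sqnorm -[X in X%:R]card_ord mulr_natl -sumr_const.
  by apply: ler_sum => i _; apply: entry.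
rewrite mulrA ler_wpM2r ?amp_sqnorm_ge0 //.
have : n%:R <= n%:R ^+ 2 :> R
  by rewrite -natrX ler_nat; case: (n) => // m; rewrite expnS expn1 leq_pmulr.
have : 0 <= n%:R :> R by rewrite ler0n.
by rewrite /c; move: (n%:R : R) => m; nra.
Qed.

End Amplification.

(** * Order isomorphisms from isometric *-homomorphisms *)

Section OrderIso.
Variables (R : realType) (A : cstarAlgType R) (H : sepHilbertType R).
Variable f : {lrmorphism A -> bop H}.
Hypothesis f_star : {morph f : a / star a}.
Hypothesis f_iso : forall a, cnorm (f a) = cnorm a.

Lemma isometric_inj : injective f.
Proof.
move=> a b ab; apply/eqP; rewrite -subr_eq0; apply/eqP/cnorm0_eq0.
by rewrite -f_iso rmorphB /= ab subrr cnorm0.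
Qed.

Lemma map_mx_cscale n c (X : 'M[A]_n) : map_mx f (cscale c X) = cscale c (map_mx f X).
Proof. by apply/matrixP => i j; rewrite !mxE linearZ. Qed.

Lemma map_mx_adj n (X : 'M[A]_n) : map_mx f (adjmx X) = adjmx (map_mx f X).
Proof. by apply/matrixP => i j; rewrite !mxE f_star. Qed.

Lemma map_mx_exp n (X : 'M[A]_n) k : map_mx f (X ^+ k) = map_mx f X ^+ k.
Proof.
elim: k => [|k IH]; first by rewrite !expr0 map_mx1.
by rewrite !exprS -!mulmxE map_mxM IH.
Qed.

Lemma mxpos_map n (X : 'M[A]_n) : mxpos X -> mxpos (map_mx f X).
Proof. by move=> [Y ->]; exists (map_mx f Y); rewrite map_mxM map_mx_adj. Qed.

(** An isometric *-homomorphism reflects positivity even though the factor Z of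
    f X = (star Z) Z need not have entries in the image of f: a new factor is built
    in M_n(A) from the powers of 1 - X/c^2. *)
Lemma mxpos_reflect n (X : 'M[A]_n) : mxpos (map_mx f X) -> mxpos X.
Proof.
move=> [Z fX]; have [c c0 cZ] := amp_bounded Z.
pose W := cscale c^-1%:C Z; pose T := 1%:M - cscale (c^-1 ^+ 2)%:C X.
have fT : map_mx f T = 1%:M - adjmx W *m W.
  rewrite map_mxB map_mx1 map_mx_cscale fX adjmx_cscale conjc_real.
  by rewrite cscaleMl cscaleMr cscaleA -rmorphM.
have [||Y sY YY] := @sqrt_1B _ _ _ T.
- have /matrixP e : map_mx f (adjmx T) = map_mx f T.
    by rewrite map_mx_adj fT adjmxB adjmx1 adjmxM adjmxK.
  apply/matrixP => i j; apply: isometric_inj.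
  by have := e i j; rewrite [LHS]mxE [RHS]mxE.
- move=> k i j; rewrite -f_iso.
  have -> : f ((T ^+ k) i j) = (map_mx f T ^+ k) i j by rewrite -map_mx_exp mxE.
  rewrite fT; apply: amp_contraction_entry; apply: amp_contractionX.
  exact: amp_contraction_1B.
exists (cscale c%:C Y).
rewrite adjmx_cscale conjc_real sY cscaleMl cscaleMr YY opprB addrC subrK !cscaleA.
by rewrite -!rmorphM -[c * c]expr2 -exprMn mulfV ?gt_eqF // expr1n rmorph1 cscale1.
Qed.

(** Isometry makes preimages of Cauchy sequences Cauchy, and A is complete. *)
Lemma nclosure_image (S : set A) :
  (f @` nclosure S = nclosure (f @` S))%classic.
Proof.
apply/seteqP; split=> [_ [a /nclosureP[x Sx [K K0 hK]] <-]|b /nclosureP[y Sy yb]].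
  apply/nclosureP; exists (f \o x) => [n|]; first by exists (x n).
  by exists K => // n; rewrite /= -rmorphB f_iso.
have /choice[x hx] n : exists a, S a /\ f a = y n by have [a] := Sy n; exists a.
have [K K0 hK] := yb.
have [a xa] : exists a, rcvg x a.
  apply: (@rcvg_exists _ _ _ (2 * K)) => [|n k nk]; first lra.
  rewrite -f_iso rmorphB /=; have [_ ->] := hx n; have [_ ->] := hx k.
  apply: le_trans (cnorm_tri b _ _) _; rewrite [cnorm (b - _)]cnormB.
  have := hK n; have := hK k.
  have : K / k.+1%:R <= K / n.+1%:R.
    by rewrite ler_wpM2l // lef_pV2 ?posrE ?ltr0n // ler_nat.
  by rewrite -mulrA; move: (K / _) (K / _) => p q; lra.
exists a; first by apply/nclosureP; exists x => // n; case: (hx n).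
apply: (@rcvg_unique _ _ y) => //; have [L L0 hL] := xa.
by exists L => // n; have [_ <-] := hx n; rewrite -rmorphB f_iso.
Qed.

Lemma order_iso_of_image (S : opsys A) (T : opsys (bop H)) :
  (f @` os_set S = os_set T)%classic ->
  exists2 phi : {linear S -> T}, unital_complete_order_iso phi &
    forall x, os_val (phi x) = f (os_val x).
Proof.
move=> fS.
have fT (x : S) : f (os_val x) \in os_pred T.
  by apply/asboolP; rewrite -fS; exists (os_val x) => //; apply/asboolP/os_valP.
have /choice[g hg] (y : T) : exists x : S, f (os_val x) = os_val y.
  have /asboolP := os_valP y; rewrite -fS => -[a Sa ay].
  by exists (OsElt (introT (asboolP _) Sa)).
pose p x : T := OsElt (fT x).
have p_lin : linear p.
  by move=> c x y; apply: val_inj; rewrite /= !linearP.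
have g_lin : linear g.
  move=> c x y; apply/val_inj/isometric_inj.
  by rewrite /= hg linearP /= !hg.
pose phi : {linear S -> T} := HB.pack p (GRing.isLinear.Build R[i] S T *:%R p p_lin).
pose psi : {linear T -> S} := HB.pack g (GRing.isLinear.Build R[i] T S *:%R g g_lin).
exists phi => //; split.
- by apply: val_inj; rewrite /= rmorph1.
- move=> n X /mxpos_map; rewrite /os_pos; congr mxpos.
  by apply/matrixP => i j; rewrite !mxE.
- exists psi; split.
  + by move=> x; apply/val_inj/isometric_inj; rewrite hg.
  + by move=> y; apply: val_inj; rewrite /= hg.
  + move=> n X hX; apply: mxpos_reflect; move: hX; rewrite /os_pos; congr mxpos.
    by apply/matrixP => i j; rewrite !mxE hg.
Qed.

End OrderIso.

(** * Spans of the generators and the isomorphism theorem *)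

Lemma lspan_image (R : realType) (A B : cstarAlgType R) (f : {lrmorphism A -> B})
  (S : set A) : (f @` lspan S = lspan (f @` S))%classic.
Proof.
apply/seteqP; split=> [_ [_ [n [c [s [Ss ->]]]] <-]|b [n [c [s [Ss ->]]]]].
  exists n, c, (f \o s); split=> [i|]; first by exists (s i).
  by rewrite linear_sum; apply: eq_bigr => i _; rewrite linearZ.
have /choice[t ht] i : exists a, S a /\ f a = s i by have [a] := Ss i; exists a.
exists (\sum_(i < n) c i *: t i).
  by exists n, c, t; split=> // i; case: (ht i).
rewrite linear_sum; apply: eq_bigr => i _; rewrite linearZ /=.
by have [_ ->] := ht i.
Qed.

Lemma span_linear_ext (R : realType) (A : cstarAlgType R) (g : nat -> A)
  (g_sa : forall k, star (g k) = g k) (V : lmodType R[i])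
  (p q : {linear span_os g_sa -> V}) :
  p (os_one _) = q (os_one _) -> (forall k, p (span_gen g_sa k) = q (span_gen g_sa k)) ->
  p =1 q.
Proof.
move=> pq1 pqg x; have /asboolP[n [c [s [Ss xE]]]] := os_valP x.
have Ss' i : s i \in os_pred (span_os g_sa).
  apply/asboolP; exists 1%N, (fun=> 1), (fun=> s i); split=> //.
  by rewrite big_ord1 scale1r.
have -> : x = \sum_(i < n) c i *: (OsElt (Ss' i) : span_os g_sa).
  by apply: val_inj; rewrite /= xE; elim/big_rec2: _ => // i y z _ ->.
rewrite !linear_sum; apply: eq_bigr => i _; rewrite !linearZ; congr (_ *: _).
case: (Ss i) => [s1|[k _ sk]].
  by have -> : OsElt (Ss' i) = os_one (span_os g_sa) by apply: val_inj.
by have -> : OsElt (Ss' i) = span_gen g_sa k by apply: val_inj.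
Qed.

Theorem theorem6p1 (R : realType)
    (A : cstarAlgType R) (u : nat -> A) (u_univ : spin_universal u)
    (H : sepHilbertType R) (v : nat -> bop H)
    (v_sa : forall k, star (v k) = v k)
    (v_unitary : forall k, unitary_elt (v k))
    (v_anti : forall i j, i != j -> v i * v j = - (v j * v i)) :
  exists phi : {linear span_os (spin_universal_sa u_univ) -> span_os v_sa},
    [/\ unital phi,
        (forall k, phi (span_gen (spin_universal_sa u_univ) k) = span_gen v_sa k),
        (forall psi : {linear span_os (spin_universal_sa u_univ) -> span_os v_sa},
          unital psi ->
          (forall k, psi (span_gen (spin_universal_sa u_univ) k) = span_gen v_sa k) ->
          psi =1 phi),
        unital_complete_order_iso phi &
        exists Phi : {linear os_closure (span_os (spin_universal_sa u_univ)) ->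
                             os_closure (span_os v_sa)},
          unital_complete_order_iso Phi /\
          forall x, Phi (os_incl x) = os_incl (phi x)].
Proof.
have [u_spin u_gen univ] := u_univ.
have v_spin : spin_relations v.
  split=> // [k|i j ij]; last by rewrite v_anti // addNr.
  by rewrite expr2 -{1}v_sa; case: (v_unitary k).
have [f [f_star fu]] := univ _ v v_spin.
have f_iso := morph_isometric f_star u_spin u_gen.
have f_span : (f @` os_set (span_os (spin_universal_sa u_univ)) =
               os_set (span_os v_sa))%classic.
  rewrite /= lspan_image image_setU image_set1 rmorph1; congr (lspan (_ `|` _)%classic).
  by rewrite image_comp; have -> : f \o u = v by apply/funext => k /=.
have [phi phi_iso phiE] := order_iso_of_image f_star f_iso f_span.
have [Phi Phi_iso PhiE] :
    exists2 Phi : {linear os_closure (span_os (spin_universal_sa u_univ)) ->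
                             os_closure (span_os v_sa)},
      unital_complete_order_iso Phi & forall x, os_val (Phi x) = f (os_val x).
  by apply: order_iso_of_image => //; rewrite /= nclosure_image // f_span.
have phi1 : unital phi by case: phi_iso.
have phiu k : phi (span_gen (spin_universal_sa u_univ) k) = span_gen v_sa k.
  by apply: val_inj; rewrite /= phiE /= fu.
exists phi; split=> //.
  by move=> psi psi1 psiu; apply: span_linear_ext => [|k]; rewrite ?psi1 ?psiu.
by exists Phi; split=> // x; apply: val_inj; rewrite /= PhiE phiE.
Qed.
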